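(* Suppose Assumptions 1, 2, 3 and 4 (stated in the context) hold and $V_T=o(T)$. Let $\{(\boldsymbol{x}_{i,t},\boldsymbol{y}_{i,t})\}$ be generated by Algorithm DOSMD-CCO (described in the context) with $$\alpha_t=\frac1{\epsilon_1}t^{-\gamma_1},\qquad \eta_t=\frac1{\epsilon_2}t^{-\gamma_2},\qquad \epsilon_1,\epsilon_2>0,\ \gamma_1,\gamma_2\in(0,1).$$ Then, for $T\ge2$ and $j\in\mathcal V$, $$\textbf{ESP-Regret}_d^j(T)\le\mathcal O\Big(\max\Big\{\Big(1+\frac{\Gamma}{1-\sigma}\Big)T^{\theta_1},\ T^{\theta_2}(1+V_T)\Big\}\Big),$$ where $\theta_1=\max\{1-\gamma_1,1-\gamma_2\}$ and $\theta_2=\max\{\gamma_1,\gamma_2\}$.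
   Context: **Problem.** $[m]=\{1,\dots,m\}$; $\|\cdot\|$ is a norm (on $\mathbb R^d$, resp. $\mathbb R^m$), $\|\cdot\|_*$ its dual norm, and matrix norms are the induced operator norms. $\boldsymbol{X}\subset\mathbb R^d$, $\boldsymbol{Y}\subset\mathbb R^m$ are convex compact sets with diameters (in $\|\cdot\|$) at most $M_X>0$, $M_Y>0$. For agents $i\in\mathcal V=[n]$ and times $t\ge1$, $f_{i,t}:\mathbb R^d\times\mathbb R^m\to\mathbb R$ is convex in the first and concave in the second argument; $f_t=\sum_{i=1}^n f_{i,t}$. For each $t$, $(\boldsymbol{x}_t^*,\boldsymbol{y}_t^* )\in\boldsymbol{X}\times\boldsymbol{Y}$ is a saddle point of $f_t$: $f_t(\boldsymbol{x}_t^*,\boldsymbol{y})\le f_t(\boldsymbol{x}_t^*,\boldsymbol{y}_t^* )\le f_t(\boldsymbol{x},\boldsymbol{y}_t^* )$ for all $\boldsymbol{x}\in\boldsymbol{X},\boldsymbol{y}\in\boldsymbol{Y}$. The expected dynamic saddle point regret of agent $j$ is $$\textbf{ESP-Regret}_d^j(T)=\Big|\mathbb E\Big[\sum_{t=1}^T f_t(\boldsymbol{x}_{j,t},\boldsymbol{y}_{j,t})-\sum_{t=1}^T f_t(\boldsymbol{x}_t^*,\boldsymbol{y}_t^* )\Big]\Big|.$$ The path-variation is $V_T=\max\{V_T^x,V_T^y\}$ with $V_T^x=\sum_{t=1}^T\|\boldsymbol{x}_{t+1}^*-B_t\boldsymbol{x}_t^*\|$, $V_T^y=\sum_{t=1}^T\|\boldsymbol{y}_{t+1}^*-C_t\boldsymbol{y}_t^*\|$.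 **$\mathcal O$ convention.** The constant hidden in $\mathcal O(\cdot)$ does not depend on $T$, $V_T$, or the quantity $\Gamma/(1-\sigma)$ displayed in the bound; it may depend on the other problem constants ($n$, $L_X,L_Y,\varrho_x,\varrho_y,K_X,K_Y$, $\epsilon_1,\epsilon_2,\gamma_1,\gamma_2$, the maxima of $\Psi_{\mathcal R}^x$ over $\boldsymbol{X}\times\boldsymbol{X}$ and $\Psi_{\mathcal R}^y$ over $\boldsymbol{Y}\times\boldsymbol{Y}$, and the initial decisions). **Network.** $\mathcal G_t=(\mathcal V,\mathcal E_t,A_t)$ is a directed time-varying graph with doubly stochastic weight matrix $A_t\in\mathbb R^{n\times n}$; $\mathcal N_i^{in}(t)=\{i\}\cup\{j:(j,i)\in\mathcal E_t\}$; for a fixed $0<\zeta<1$, $[A_t]_{ij}>\zeta$ if $j\in\mathcal N_i^{in}(t)$ and $[A_t]_{ij}=0$ otherwise. **Bregman divergences.** $\mathcal R^x:\mathbb R^d\to\mathbb R$, $\mathcal R^y:\mathbb R^m\to\mathbb R$ are differentiable and respectively $\varrho_x$- and $\varrho_y$-strongly convex (w.r.t. $\|\cdot\|$) on $\boldsymbol{X}$, $\boldsymbol{Y}$; $\Psi_{\mathcal R}^x(\boldsymbol{x}_a,\boldsymbol{x}_b)=\mathcal R^x(\boldsymbol{x}_a)-\mathcal R^x(\boldsymbol{x}_b)-\langle\nabla\mathcal R^x(\boldsymbol{x}_b),\boldsymbol{x}_a-\boldsymbol{x}_b\rangle$, and $\Psi_{\mathcal R}^y$ is defined analogously from $\mathcal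 R^y$. Thus $\Psi_{\mathcal R}^x(\boldsymbol{x}_a,\boldsymbol{x}_b)\ge\frac{\varrho_x}{2}\|\boldsymbol{x}_a-\boldsymbol{x}_b\|^2$ on $\boldsymbol{X}$, and likewise for $y$ on $\boldsymbol{Y}$. **Algorithm DOSMD-CCO.** Given initial decisions $\boldsymbol{x}_{i,1}\in\boldsymbol{X},\boldsymbol{y}_{i,1}\in\boldsymbol{Y}$, step sizes $\alpha_t,\eta_t>0$, and prediction matrices $B_t\in\mathbb R^{d\times d}$, $C_t\in\mathbb R^{m\times m}$. At each $t=1,\dots,T$, each agent $i$: (1) obtains stochastic gradients $\widetilde\nabla_{i,t}^x=\widetilde\nabla_{i,t}^x(\boldsymbol{x}_{i,t},\boldsymbol{y}_{i,t})$, $\widetilde\nabla_{i,t}^y=\widetilde\nabla_{i,t}^y(\boldsymbol{x}_{i,t},\boldsymbol{y}_{i,t})$ (from two independent stochastic oracles) and finds $\boldsymbol{z}_{i,t},\boldsymbol{v}_{i,t}$ with $\nabla\mathcal R^x(\boldsymbol{z}_{i,t})=\nabla\mathcal R^x(\boldsymbol{x}_{i,t})-\alpha_t\widetilde\nabla_{i,t}^x$, $\nabla\mathcal R^y(\boldsymbol{v}_{i,t})=\nabla\mathcal R^y(\boldsymbol{y}_{i,t})+\eta_t\widetilde\nabla_{i,t}^y$; (2) sets $\tilde{\boldsymbol{x}}_{i,t}=\arg\min_{\boldsymbol{x}\in\boldsymbol{X}}\Psi_{\mathcal R}^x(\boldsymbol{x},\boldsymbol{z}_{i,t})$, $\tilde{\boldsymbol{y}}_{i,t}=\arg\min_{\boldsymbol{y}\in\boldsymbol{Y}}\Psi_{\mathcal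 R}^y(\boldsymbol{y},\boldsymbol{v}_{i,t})$; (3) sets $\boldsymbol{s}_{i,t}^x=B_t\tilde{\boldsymbol{x}}_{i,t}$, $\boldsymbol{s}_{i,t}^y=C_t\tilde{\boldsymbol{y}}_{i,t}$; (4) sets $\boldsymbol{x}_{i,t+1}=\sum_{j\in\mathcal N_i^{in}(t)}[A_t]_{ij}\boldsymbol{s}_{j,t}^x$, $\boldsymbol{y}_{i,t+1}=\sum_{j\in\mathcal N_i^{in}(t)}[A_t]_{ij}\boldsymbol{s}_{j,t}^y$. $\mathcal F_t$ is the $\sigma$-field of the entire history of random variables up to time $t$. **Assumption 1.** There is a positive integer $Q$ such that for all integers $k\ge0$ the graph $(\mathcal V,\bigcup_{i=kQ+1}^{(k+1)Q}\mathcal E_i)$ is strongly connected. Set $\Gamma=(1-\zeta/(4n^2))^{(1-2Q)/Q}$, $\sigma=(1-\zeta/(4n^2))^{1/Q}$. **Assumption 2.** For all $\boldsymbol{x}\in\boldsymbol{X},\boldsymbol{y}\in\boldsymbol{Y}$: $\mathbb E[\widetilde\nabla_{i,t}^x(\boldsymbol{x},\boldsymbol{y})|\mathcal F_{t-1}]=\nabla_xf_{i,t}(\boldsymbol{x},\boldsymbol{y})$, $\mathbb E[\widetilde\nabla_{i,t}^y(\boldsymbol{x},\boldsymbol{y})|\mathcal F_{t-1}]=\nabla_yf_{i,t}(\boldsymbol{x},\boldsymbol{y})$, $\mathbb E[\|\widetilde\nabla_{i,t}^x(\boldsymbol{x},\boldsymbol{y})\|_*^2|\mathcal F_{t-1}]\le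 L_X^2$, $\mathbb E[\|\widetilde\nabla_{i,t}^y(\boldsymbol{x},\boldsymbol{y})\|_*^2|\mathcal F_{t-1}]\le L_Y^2$. **Assumption 3.** (i) For all $\boldsymbol{x}_a,\boldsymbol{x}_b,\boldsymbol{x}_c\in\boldsymbol{X}$ and $\boldsymbol{y}_a,\boldsymbol{y}_b,\boldsymbol{y}_c\in\boldsymbol{Y}$: $|\Psi_{\mathcal R}^x(\boldsymbol{x}_a,\boldsymbol{x}_c)-\Psi_{\mathcal R}^x(\boldsymbol{x}_b,\boldsymbol{x}_c)|\le K_X\|\boldsymbol{x}_a-\boldsymbol{x}_b\|$, $|\Psi_{\mathcal R}^y(\boldsymbol{y}_a,\boldsymbol{y}_c)-\Psi_{\mathcal R}^y(\boldsymbol{y}_b,\boldsymbol{y}_c)|\le K_Y\|\boldsymbol{y}_a-\boldsymbol{y}_b\|$. (ii) For all $\boldsymbol{x},\boldsymbol{z}_i\in\mathbb R^d$, $\boldsymbol{y},\boldsymbol{v}_i\in\mathbb R^m$ and all $\boldsymbol{s}$ in the probability simplex of $\mathbb R^n$: $\Psi_{\mathcal R}^x(\boldsymbol{x},\sum_i[\boldsymbol{s}]_i\boldsymbol{z}_i)\le\sum_i[\boldsymbol{s}]_i\Psi_{\mathcal R}^x(\boldsymbol{x},\boldsymbol{z}_i)$ and $\Psi_{\mathcal R}^y(\boldsymbol{y},\sum_i[\boldsymbol{s}]_i\boldsymbol{v}_i)\le\sum_i[\boldsymbol{s}]_i\Psi_{\mathcal R}^y(\boldsymbol{y},\boldsymbol{v}_i)$.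 **Assumption 4.** For all $t\in[T]$, $\boldsymbol{x}_a,\boldsymbol{x}_b\in\boldsymbol{X}$, $\boldsymbol{y}_a,\boldsymbol{y}_b\in\boldsymbol{Y}$: $\Psi_{\mathcal R}^x(B_t\boldsymbol{x}_a,B_t\boldsymbol{x}_b)\le\Psi_{\mathcal R}^x(\boldsymbol{x}_a,\boldsymbol{x}_b)$, $\Psi_{\mathcal R}^y(C_t\boldsymbol{y}_a,C_t\boldsymbol{y}_b)\le\Psi_{\mathcal R}^y(\boldsymbol{y}_a,\boldsymbol{y}_b)$; $\|B_t\|\le1$, $\|C_t\|\le1$; and $B_t\boldsymbol{x}\in\boldsymbol{X}$, $C_t\boldsymbol{y}\in\boldsymbol{Y}$ whenever $\boldsymbol{x}\in\boldsymbol{X}$, $\boldsymbol{y}\in\boldsymbol{Y}$.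
   Formalization: Assumption 2 is required at all F_{t-1}-measurable random points of X×Y, not only at fixed x, y; with fixed points alone an oracle biased exactly at the random decision x_{i,t} satisfies it and has linear regret. *)

(* Defs.v *)
From HB Require Import structures.
From mathcomp Require Import all_boot all_order all_algebra.
From mathcomp Require Import all_classical all_reals all_analysis.

Set Implicit Arguments.
Unset Strict Implicit.
Unset Printing Implicit Defensive.

Import Order.TTheory GRing.Theory Num.Theory.
Import numFieldNormedType.Exports.

Local Open Scope classical_set_scope.
Local Open Scope ring_scope.

(* Points of R^d are column vectors 'cV[R]_d.  Their library topology (that of
   the sup norm) is the usual one and is used only for compactness and
   differentiability; the norms of the problem are arbitrary functions
   satisfying is_norm. *)

Section Euclidean.
Context {R : realType}.

Definition is_norm (d : nat) (N : 'cV[R]_d -> R) : Prop :=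
  [/\ forall u v, N (u + v) <= N u + N v,
      forall a u, N (a *: u) = `|a| * N u
    & forall u, N u = 0 -> u = 0].

Definition inner (d : nat) (u v : 'cV[R]_d) : R := \sum_k u k 0 * v k 0.

Definition dual_norm (d : nat) (N : 'cV[R]_d -> R) (u : 'cV[R]_d) : R :=
  sup [set inner u v | v in [set v | N v <= 1]].

Definition op_norm (d : nat) (N : 'cV[R]_d -> R) (B : 'M[R]_d) : R :=
  sup [set N (B *m v) | v in [set v | N v <= 1]].

(* Meaningful at points of differentiability only. *)
Definition gradient (d : nat) (g : 'cV[R]_d -> R) (x : 'cV[R]_d) : 'cV[R]_d :=
  \col_k 'D_(delta_mx k 0) (g : 'cV[R]_d -> R^o) x.

Definition strongly_convex_on (d : nat) (N : 'cV[R]_d -> R)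
    (X : set 'cV[R]_d) (rho : R) (g : 'cV[R]_d -> R) : Prop :=
  forall (a b : 'cV[R]_d) (s : R), X a -> X b -> 0 <= s <= 1 ->
    g (s *: a + (1 - s) *: b)
      <= s * g a + (1 - s) * g b - rho / 2 * s * (1 - s) * N (a - b) ^+ 2.

Definition bregman (d : nat) (g : 'cV[R]_d -> R) (a b : 'cV[R]_d) : R :=
  g a - g b - inner (gradient g b) (a - b).

(* The maximum of the divergence over X x X, as a supremum so that attainment
   need not be argued; the Lipschitz condition below, taken at b = c, bounds
   the divergence on X x X by KX times the diameter of X. *)
Definition bregman_max (d : nat) (g : 'cV[R]_d -> R) (X : set 'cV[R]_d) : R :=
  sup [set bregman g p.1 p.2 | p in X `*` X].

Definition is_argmin_on (d : nat) (X : set 'cV[R]_d) (g : 'cV[R]_d -> R)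
    (a : 'cV[R]_d) : Prop :=
  X a /\ forall b, X b -> g a <= g b.

Definition bregman_lipschitz (d : nat) (N : 'cV[R]_d -> R)
    (X : set 'cV[R]_d) (g : 'cV[R]_d -> R) (K : R) : Prop :=
  forall a b c, X a -> X b -> X c ->
    `|bregman g a c - bregman g b c| <= K * N (a - b).

Definition bregman_separately_convex (n d : nat) (g : 'cV[R]_d -> R) : Prop :=
  forall (x : 'cV[R]_d) (z : 'I_n -> 'cV[R]_d) (s : 'I_n -> R),
    (forall i, 0 <= s i) -> \sum_i s i = 1 ->
    bregman g x (\sum_i s i *: z i) <= \sum_i s i * bregman g x (z i).

Definition admissible_prediction (d : nat) (N : 'cV[R]_d -> R)
    (X : set 'cV[R]_d) (g : 'cV[R]_d -> R) (B : 'M[R]_d) : Prop :=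
  [/\ forall a b, X a -> X b ->
        bregman g (B *m a) (B *m b) <= bregman g a b,
      op_norm N B <= 1
    & forall a, X a -> X (B *m a)].

Definition saddle_point (d m : nat) (X : set 'cV[R]_d) (Y : set 'cV[R]_m)
    (F : 'cV[R]_d -> 'cV[R]_m -> R) (xs : 'cV[R]_d) (ys : 'cV[R]_m) : Prop :=
  [/\ X xs, Y ys,
      forall y, Y y -> F xs y <= F xs ys
    & forall x, X x -> F xs ys <= F x ys].

Definition path_length (d : nat) (N : 'cV[R]_d -> R) (B : nat -> 'M[R]_d)
    (xs : nat -> 'cV[R]_d) (T : nat) : R :=
  \sum_(1 <= t < T.+1) N (xs t.+1 - B t *m xs t).

Definition path_variation (d m : nat)
    (nX : 'cV[R]_d -> R) (nY : 'cV[R]_m -> R)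
    (B : nat -> 'M[R]_d) (C : nat -> 'M[R]_m)
    (xs : nat -> 'cV[R]_d) (ys : nat -> 'cV[R]_m) (T : nat) : R :=
  Num.max (path_length nX B xs T) (path_length nY C ys T).

Definition step_size (eps gamma : R) (t : nat) : R :=
  eps^-1 * t%:R `^ (- gamma).

End Euclidean.

Section Network.
Context {R : realType}.
Variable n : nat.

(* E t j i : there is an edge from j to i at time t. *)
Definition in_neighbour (E : nat -> rel 'I_n) (t : nat) (i j : 'I_n) : bool :=
  (j == i) || E t j i.

Definition doubly_stochastic (A : 'M[R]_n) : Prop :=
  [/\ forall i j, 0 <= A i j,
      forall i, \sum_j A i j = 1
    & forall j, \sum_i A i j = 1].

Definition weight_matrix (zeta : R) (E : nat -> rel 'I_n) (t : nat)
    (A : 'M[R]_n) : Prop :=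
  [/\ doubly_stochastic A,
      forall i j, in_neighbour E t i j -> zeta < A i j
    & forall i j, ~~ in_neighbour E t i j -> A i j = 0].

(* The union of the edge sets over the times kQ+1, ..., (k+1)Q is strongly
   connected for every k. *)
Definition jointly_strongly_connected (Q : nat) (E : nat -> rel 'I_n) : Prop :=
  forall (k : nat) (i j : 'I_n),
    connect (fun a b => [exists s : 'I_Q, E (k * Q + s).+1 a b]) i j.

Definition net_Gamma (Q : nat) (zeta : R) : R :=
  (1 - zeta / (4 * n%:R ^+ 2)) `^ ((1 - 2 * Q%:R) / Q%:R).

Definition net_sigma (Q : nat) (zeta : R) : R :=
  (1 - zeta / (4 * n%:R ^+ 2)) `^ (1 / Q%:R).

End Network.

Section Probability.
Context {R : realType} {disp : measure_display} {Omega : measurableType disp}.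

Definition coord_events (d : nat) (u : Omega -> 'cV[R]_d)
    : set (set Omega) :=
  \bigcup_(k in [set: 'I_d])
    preimage_set_system setT (fun w => u w k 0) measurable.

(* u is measurable with respect to the sigma-field G. *)
Definition measurable_vec (G : set (set Omega)) (d : nat)
    (u : Omega -> 'cV[R]_d) : Prop :=
  coord_events u `<=` G.

(* W is a version of E[Z | G]. *)
Definition is_condexp (P : probability Omega R) (G : set (set Omega))
    (Z W : Omega -> R) : Prop :=
  [/\ P.-integrable setT (EFin \o Z),
      P.-integrable setT (EFin \o W),
      preimage_set_system setT W measurable `<=` G
    & forall S, G S ->
        (\int[P]_(w in S) (Z w)%:E = \int[P]_(w in S) (W w)%:E)%E].

Definition independent_sigma (P : probability Omega R)
    (G H : set (set Omega)) : Prop :=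
  forall S S', G S -> H S' -> P (S `&` S') = (P S * P S')%E.

End Probability.

Section Algorithm.
Context {R : realType} {disp : measure_display} {Omega : measurableType disp}.
Variables n d m : nat.

(* A stochastic gradient oracle with answers in R^p: the answer to agent i at
   time t queried at (x, y), as a random vector. *)
Definition oracle (p : nat) : Type :=
  'I_n -> nat -> 'cV[R]_d -> 'cV[R]_m -> Omega -> 'cV[R]_p.

(* The random sequences produced by a run, indexed by agent and time; the
   index 0 is unused. *)
Record run := Run {
  run_x : 'I_n -> nat -> Omega -> 'cV[R]_d;
  run_y : 'I_n -> nat -> Omega -> 'cV[R]_m;
  run_z : 'I_n -> nat -> Omega -> 'cV[R]_d;
  run_v : 'I_n -> nat -> Omega -> 'cV[R]_m;
  run_xtilde : 'I_n -> nat -> Omega -> 'cV[R]_d;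
  run_ytilde : 'I_n -> nat -> Omega -> 'cV[R]_m }.

Definition query (p : nat) (g : oracle p) (r : run) (i : 'I_n) (t : nat)
    : Omega -> 'cV[R]_p :=
  fun w => g i t (run_x r i t w) (run_y r i t w) w.

Definition round_events (gx : oracle d) (gy : oracle m) (r : run)
    (i : 'I_n) (s : nat) : set (set Omega) :=
  coord_events (run_x r i s) `|` coord_events (run_y r i s) `|`
  coord_events (query gx r i s) `|` coord_events (query gy r i s) `|`
  coord_events (run_z r i s) `|` coord_events (run_v r i s) `|`
  coord_events (run_xtilde r i s) `|` coord_events (run_ytilde r i s).

(* The sigma-field of all random variables of rounds 1, ..., t; it is trivial
   for t = 0.  The vectors obtained deterministically from these, such as the
   next decisions, are measurable with respect to it. *)
Definition history (gx : oracle d) (gy : oracle m) (r : run) (t : nat)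
    : set (set Omega) :=
  <<s \bigcup_(s in [set s | (1 <= s <= t)%N])
        \bigcup_(i in [set: 'I_n]) round_events gx gy r i s >>.

Definition oracle_sigma (p : nat) (g : oracle p) (X : set 'cV[R]_d)
    (Y : set 'cV[R]_m) (i : 'I_n) (t : nat) : set (set Omega) :=
  <<s \bigcup_(q in X `*` Y) coord_events (g i t q.1 q.2) >>.

(* r is a run of the algorithm up to the horizon T. *)
Definition dosmd_cco_run (X : set 'cV[R]_d) (Y : set 'cV[R]_m)
    (Rx : 'cV[R]_d -> R) (Ry : 'cV[R]_m -> R)
    (E : nat -> rel 'I_n) (A : nat -> 'M[R]_n)
    (B : nat -> 'M[R]_d) (C : nat -> 'M[R]_m)
    (alpha eta : nat -> R) (x1 : 'I_n -> 'cV[R]_d) (y1 : 'I_n -> 'cV[R]_m)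
    (gx : oracle d) (gy : oracle m) (r : run) (T : nat) : Prop :=
  (forall i w, run_x r i 1 w = x1 i /\ run_y r i 1 w = y1 i) /\
  forall t, (1 <= t <= T)%N -> forall i,
    round_events gx gy r i t `<=` measurable /\
    forall w,
      [/\ gradient Rx (run_z r i t w)
            = gradient Rx (run_x r i t w) - alpha t *: query gx r i t w
          /\ gradient Ry (run_v r i t w)
            = gradient Ry (run_y r i t w) + eta t *: query gy r i t w,
          is_argmin_on X (fun x => bregman Rx x (run_z r i t w))
            (run_xtilde r i t w),
          is_argmin_on Y (fun y => bregman Ry y (run_v r i t w))
            (run_ytilde r i t w),
          run_x r i t.+1 w = \sum_(j | in_neighbour E t i j)
            A t i j *: (B t *m run_xtilde r j t w)
        & run_y r i t.+1 w = \sum_(j | in_neighbour E t i j)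
            A t i j *: (C t *m run_ytilde r j t w)].

(* Conditional unbiasedness and second-moment bounds of the oracles up to T.
   Query points are fixed conditionally on the past, that is, they range over
   the (X x Y)-valued (history (t - 1))-measurable random points; constant
   points are a special case.  Quantifying over constant points only would say
   nothing about the answer at the random decisions, since an exceptional null
   set may depend on the point. *)
Definition unbiased_bounded_oracles (P : probability Omega R)
    (nX : 'cV[R]_d -> R) (nY : 'cV[R]_m -> R)
    (X : set 'cV[R]_d) (Y : set 'cV[R]_m)
    (f : 'I_n -> nat -> 'cV[R]_d -> 'cV[R]_m -> R) (LX LY : R)
    (gx : oracle d) (gy : oracle m) (r : run) (T : nat) : Prop :=
  forall i t, (1 <= t <= T)%N ->
  let past := history gx gy r t.-1 in
  forall (u : Omega -> 'cV[R]_d) (v : Omega -> 'cV[R]_m),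
    (forall w, X (u w)) -> (forall w, Y (v w)) ->
    measurable_vec past u -> measurable_vec past v ->
    [/\ forall k, is_condexp P past
          (fun w => gx i t (u w) (v w) w k 0)
          (fun w => gradient (fun x => f i t x (v w)) (u w) k 0),
        forall k, is_condexp P past
          (fun w => gy i t (u w) (v w) w k 0)
          (fun w => gradient (fun y => f i t (u w) y) (v w) k 0),
        exists2 S : Omega -> R,
          is_condexp P past
            (fun w => dual_norm nX (gx i t (u w) (v w) w) ^+ 2) S
          & {ae P, forall w, S w <= LX ^+ 2}
      & exists2 S : Omega -> R,
          is_condexp P past
            (fun w => dual_norm nY (gy i t (u w) (v w) w) ^+ 2) S
          & {ae P, forall w, S w <= LY ^+ 2}].

Definition independent_oracles (P : probability Omega R)
    (X : set 'cV[R]_d) (Y : set 'cV[R]_m)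
    (gx : oracle d) (gy : oracle m) (T : nat) : Prop :=
  forall i t, (1 <= t <= T)%N ->
    independent_sigma P (oracle_sigma gx X Y i t) (oracle_sigma gy X Y i t).

Definition total_payoff (f : 'I_n -> nat -> 'cV[R]_d -> 'cV[R]_m -> R)
    (t : nat) (x : 'cV[R]_d) (y : 'cV[R]_m) : R :=
  \sum_i f i t x y.

Definition esp_regret (P : probability Omega R)
    (f : 'I_n -> nat -> 'cV[R]_d -> 'cV[R]_m -> R)
    (xs : nat -> 'cV[R]_d) (ys : nat -> 'cV[R]_m)
    (r : run) (j : 'I_n) (T : nat) : \bar R :=
  let gap : Omega -> R := fun w =>
    \sum_(1 <= t < T.+1) total_payoff f t (run_x r j t w) (run_y r j t w)
    - \sum_(1 <= t < T.+1) total_payoff f t (xs t) (ys t) in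
  `| 'E_P[gap] |%E.

End Algorithm.

Arguments oracle R {disp} Omega n d m p.
Arguments run R {disp} Omega n d m.

(* Main.v *)
(* Write (xs, ys) for the saddle point at time t.  By the saddle property and
   convexity-concavity, agent j satisfies
     f_t(x_j, y_j) - f_t(xs, ys) <= sum_i <grad_x f_i(x_i, y_i), x_i - xs>
                                    + O(max_i |x_i - x_j| + max_i |y_i - y_j|),
   and the other side is the same statement for -f with x and y exchanged.

   In expectation the gradients may be replaced by the oracle answers, since x_i
   is determined by the past, and the linear terms telescope through the Bregman
   divergences to the comparators at the cost of the path variation.

   The disagreement is a superposition of the displacements of the mirror steps,
   each spread by a product of the weight matrices.  Over a window of 2Q rounds
   such a product contracts the sum of squared differences of the coordinates by
   1 - zeta / n^3: the coordinates have a gap of at least (max - min) / n, and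
   the first edge across that gap already loses enough variance.  Hence the
   deviations of a product sum up to O(Q / zeta), and
   Gamma / (1 - sigma) >= 2 n^2 Q / zeta. *)

Require Import Defs.
From HB Require Import structures.
From mathcomp Require Import all_boot all_order all_algebra.
From mathcomp Require Import all_classical all_reals all_analysis.
From mathcomp Require Import ring lra zify.

Set Implicit Arguments.
Unset Strict Implicit.
Unset Printing Implicit Defensive.

Import Order.TTheory GRing.Theory Num.Theory.
Import numFieldNormedType.Exports.

Local Open Scope classical_set_scope.
Local Open Scope ring_scope.

(** * Averaging over the network *)

Section Mixing.
Context {R : realType} {n : nat}.
Implicit Types (A : 'M[R]_n) (y : 'cV[R]_n) (zeta : R).

(** The constant of the bound is fixed before the norms, the decision sets and the network are
    given, and this decides which estimates are admissible. The diameters [MX], [MY] and the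
    constants comparing a norm with the coordinates only serve to make suprema finite and functions
    integrable. Distances inside a decision set are measured by the maximal Bregman divergence, and
    the payoffs get Lipschitz constants [1 + L ^+ 2] from the second moments of the oracles, where u
    <= 1 + u^2 takes the place of Jensen's inequality.

    Payoffs along a run are not known to be measurable. The regret gap is therefore never split
    under the integral: it is squeezed pointwise between integrable functions, and only their
    integrals are computed.

    Disagreement matters only summed over time. After exchanging sums, a displacement at time [s] is
    charged with the deviations of the weight products at all later times, so a bound on the sum of
    these deviations suffices, without entrywise geometric decay at rate [net_sigma]. *)

Definition dispersion y : R := \sum_i \sum_j (y i 0 - y j 0) ^+ 2.

Lemma dispersion_ge0 y : 0 <= dispersion y.
Proof. by apply: sumr_ge0 => i _; apply: sumr_ge0 => j _; exact: sqr_ge0. Qed.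

Lemma sqr_diff_le_dispersion y i j : (y i 0 - y j 0) ^+ 2 <= dispersion y.
Proof.
rewrite /dispersion (bigD1 i) //= (bigD1 j) //= -addrA lerDl.
by rewrite addr_ge0 // sumr_ge0 // => k _; rewrite ?sqr_ge0 // sumr_ge0 // => l _; rewrite sqr_ge0.
Qed.

Lemma dispersion_le y c : (forall i j, `|y i 0 - y j 0| <= c) ->
  dispersion y <= n%:R ^+ 2 * c ^+ 2.
Proof.
move=> yc; have -> : n%:R ^+ 2 * c ^+ 2 = \sum_(i < n) \sum_(j < n) c ^+ 2.
  by rewrite !sumr_const !card_ord -mulrnA -[RHS]mulr_natl natrM; ring.
apply: ler_sum => i _; apply: ler_sum => j _.
by rewrite -real_normK ?num_real // lerXn2r ?nnegrE ?normr_ge0 // (le_trans _ (yc i j)).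
Qed.

Lemma dispersionE y :
  dispersion y = 2 * n%:R * (\sum_i y i 0 ^+ 2) - 2 * (\sum_i y i 0) ^+ 2.
Proof.
have rowE i : \sum_j (y i 0 - y j 0) ^+ 2 =
    n%:R * y i 0 ^+ 2 - 2 * (\sum_j y j 0) * y i 0 + \sum_j y j 0 ^+ 2.
  rewrite (eq_bigr (fun j => y i 0 ^+ 2 - 2 * y i 0 * y j 0 + y j 0 ^+ 2)); last first.
    by move=> j _; ring.
  by rewrite big_split sumrB /= sumr_const card_ord -mulr_sumr -[_ *+ n]mulr_natl; ring.
rewrite /dispersion (eq_bigr _ (fun i _ => rowE i)) big_split sumrB /=.
by rewrite sumr_const card_ord -!mulr_sumr -[_ *+ n]mulr_natl; ring.
Qed.

Lemma weighted_variance (p x : 'I_n -> R) : \sum_j p j = 1 ->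
  \sum_j p j * (x j - \sum_k p k * x k) ^+ 2
  = \sum_j p j * x j ^+ 2 - (\sum_k p k * x k) ^+ 2.
Proof.
move=> p1; set mu := \sum_k p k * x k.
rewrite (eq_bigr (fun j => p j * x j ^+ 2 + (- 2 * mu * (p j * x j) + p j * mu ^+ 2))).
  by rewrite !big_split /= -mulr_sumr -mulr_suml p1 -/mu; ring.
by move=> j _; ring.
Qed.

(** Unit column sums preserve the total, so by [dispersionE] only the sum of squares can change;
    unit row sums make its loss in each row the weighted variance of that row. *)
Lemma dispersion_mulmx A y : doubly_stochastic A ->
  dispersion (A *m y) = dispersion y
    - 2 * n%:R * \sum_i \sum_j A i j * (y j 0 - (A *m y) i 0) ^+ 2.
Proof.
case=> _ Ar Ac.
have -> : \sum_i \sum_j A i j * (y j 0 - (A *m y) i 0) ^+ 2 =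
    \sum_j y j 0 ^+ 2 - \sum_i (A *m y) i 0 ^+ 2.
  under eq_bigr => i _ do rewrite mxE (weighted_variance _ (Ar i)).
  rewrite sumrB exchange_big /=; congr (_ - _).
    by apply: eq_bigr => j _; rewrite -mulr_suml Ac mul1r.
  by apply: eq_bigr => i _; rewrite mxE.
have sum_eq : \sum_i (A *m y) i 0 = \sum_i y i 0.
  under eq_bigr => i _ do rewrite mxE.
  by rewrite exchange_big /=; apply: eq_bigr => j _; rewrite -mulr_suml Ac mul1r.
rewrite !dispersionE sum_eq; ring.
Qed.

Lemma dispersion_mulmx_le A y : doubly_stochastic A ->
  dispersion (A *m y) <= dispersion y.
Proof.
move=> dA; rewrite dispersion_mulmx // gerBl mulr_ge0 //.
case: dA => A0 _ _; apply: sumr_ge0 => i _; apply: sumr_ge0 => j _.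
by rewrite mulr_ge0 ?sqr_ge0.
Qed.

(** Only the weights of [i] itself and of [j] in row [i] are kept. Whatever the mean mu, (y_i -
    mu)^2 + (y_j - mu)^2 >= (y_i - y_j)^2 / 2, which halves the factor 2n. For [j = i] the two
    weights would be a single summand, hence the separate case. *)
Lemma dispersion_mulmx_drop A y zeta i j : doubly_stochastic A ->
  0 <= zeta -> zeta <= A i i -> zeta <= A i j ->
  dispersion (A *m y) <= dispersion y - n%:R * zeta * (y i 0 - y j 0) ^+ 2.
Proof.
move=> dA z0 Aii Aij; have [->|nij] := eqVneq j i.
  by rewrite subrr expr0n mulr0 subr0 dispersion_mulmx_le.
rewrite dispersion_mulmx // lerD2l lerN2.
have [A0 _ _] := dA.
set mu := (A *m y) i 0.
have sq_drop : zeta * (y i 0 - y j 0) ^+ 2 <=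
    2 * (A i i * (y i 0 - mu) ^+ 2 + A i j * (y j 0 - mu) ^+ 2).
  apply: (@le_trans _ _ (2 * (zeta * (y i 0 - mu) ^+ 2 + zeta * (y j 0 - mu) ^+ 2))).
    have := sqr_ge0 ((y i 0 - mu) + (y j 0 - mu)); nra.
  by rewrite ler_pM2l // lerD // ler_wpM2r // sqr_ge0.
rewrite (mulrC 2) -!mulrA ler_wpM2l //; apply: (le_trans sq_drop).
rewrite ler_pM2l // (bigD1 i) //= (bigD1 i) //= (bigD1 j) //= -/mu -!addrA lerD2l lerDl.
by rewrite addr_ge0 // ?sumr_ge0 // => k _; rewrite ?sumr_ge0 // => *; rewrite mulr_ge0 ?sqr_ge0.
Qed.

(* The n intervals of length (max - min) / n that cover (min, max] cannot all
   contain a coordinate, since the minimal coordinate lies in none of them. *)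
Lemma coordinate_gap y (i0 i1 : 'I_n) :
  (forall i, y i0 0 <= y i 0 <= y i1 0) -> y i0 0 < y i1 0 ->
  exists a b, [/\ y i0 0 <= a, b <= y i1 0, b - a = (y i1 0 - y i0 0) / n%:R
    & forall i, (y i 0 <= a) || (b < y i 0)].
Proof.
move=> ymm lt01; set s := (y i1 0 - y i0 0) / n%:R.
have n0 : 0 < n%:R :> R by rewrite ltr0n (leq_trans _ (ltn_ord i0)).
have s0 : 0 < s by rewrite divr_gt0 // subr_gt0.
pose a (k : nat) := y i0 0 + k%:R * s.
have aS k : a k.+1 = a k + s by rewrite /a -natr1; ring.
have [[k gapk]|nogap] := pselect (exists k : 'I_n,
    forall i, (y i 0 <= a k) || (a k.+1 < y i 0)).
  exists (a k), (a k.+1); split => //.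
  - by rewrite lerDl mulr_ge0 // ltW.
  - have -> : y i1 0 = a n by rewrite /a mulrC divfK ?gt_eqF// addrC subrK.
    by rewrite /a lerD2l ler_wpM2r ?ler_nat // ltW.
  - by rewrite aS addrAC subrr add0r.
have /choice[g gP] : forall k : 'I_n, exists i, a k < y i 0 <= a k.+1.
  move=> k; apply: contrapT => nk; apply: nogap; exists k => i.
  rewrite leNgt -implybE; apply/implyP => aki; rewrite ltNge; apply/negP => ik.
  by apply: nk; exists i; rewrite aki.
have ginj : injective g.
  have anat p q : a p < a q.+1 -> (p <= q)%N.
    by rewrite /a ltrD2l ltr_pM2r // ltr_nat ltnS.
  move=> k l gkl; apply/val_inj/eqP; rewrite eqn_leq.
  have /andP[k1 k2] := gP k; have /andP[l1 l2] := gP l; rewrite gkl in k1 k2.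
  by rewrite !anat // ?(lt_le_trans k1) ?(lt_le_trans l1).
have /codomP[k i0k] := injF_onto ginj i0.
have /andP[+ _] := gP k.
by rewrite -i0k ltNge /a lerDl mulr_ge0 // ltW.
Qed.

Variables (zeta : R) (Q : nat) (E : nat -> rel 'I_n) (A : nat -> 'M[R]_n).
Hypothesis zeta0 : 0 < zeta.
Hypothesis AE : forall t, (1 <= t)%N -> weight_matrix zeta E t (A t).
Hypothesis Q0 : (0 < Q)%N.
Hypothesis jsc : jointly_strongly_connected Q E.

Let cut_crossed (S : pred 'I_n) t := [exists i, exists j, (S i != S j) && E t j i].

(** Any 2Q consecutive rounds contain a complete block of Q rounds. Without a crossing edge in it,
    [S] would be closed for the union graph of the block, against connectivity. *)
Lemma cut_crossing (S : pred 'I_n) t i j : (1 <= t)%N -> S i -> ~~ S j ->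
  exists2 k, (k < Q.*2)%N & cut_crossed S (t + k).
Proof.
(* [q] is t / Q rounded up: the block q Q + 1, ..., (q + 1) Q starts no earlier than t and ends
   before t + 2Q. *)
move=> t1 Si Sj; set q := ((t + Q).-1 %/ Q)%N.
have qlo : (t <= (q * Q).+1)%N.
  have := @ltn_ceil (t + Q).-1 Q Q0; rewrite -/q mulSn; lia.
have qhi : (q * Q < t + Q)%N.
  have := leq_divM (t + Q).-1 Q; rewrite -/q; lia.
apply: contrapT => nocross.
have cl : fingraph.closed (fun a b => [exists s : 'I_Q, E (q * Q + s).+1 a b]) S.
  move=> a b /existsP[s sab]; apply/eqP/contraT => nab; case: nocross.
  exists ((q * Q + s).+1 - t)%N; first by have := ltn_ord s; lia.
  rewrite subnKC; last by lia.
  by apply/existsP; exists b; apply/existsP; exists a; rewrite sab andbT eq_sym.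
have := closed_connect cl (jsc q i j).
by rewrite !unfold_in Si (negbTE Sj).
Qed.

Variables (s : nat) (y : nat -> 'cV[R]_n).
Hypothesis s1 : (1 <= s)%N.
Hypothesis yS : forall t, (s <= t)%N -> y t.+1 = A t *m y t.

Lemma dispersion_noninc t k : (s <= t)%N -> dispersion (y (t + k)) <= dispersion (y t).
Proof.
move=> st; elim: k => [|k IH]; first by rewrite addn0.
rewrite addnS yS ?(leq_trans st) ?leq_addr //.
apply: (le_trans _ IH); apply: dispersion_mulmx_le.
by case: (AE (leq_trans s1 (leq_trans st (leq_addr k t)))).
Qed.

(** The loss n zeta ((max - min) / n)^2 at the first crossing is compared with the bound n^2 (max -
    min)^2 on the whole dispersion; the quotient is zeta / n^3. *)
Lemma dispersion_window t : (s <= t)%N ->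
  dispersion (y (t + Q.*2)) <= (1 - zeta / n%:R ^+ 3) * dispersion (y t).
Proof.
move=> st.
have [n0|] := posnP n.
  by rewrite /dispersion !big1 ?mulr0 // => i; have := ltn_ord i; lia.
move=> n0; have nR : 0 < n%:R :> R by rewrite ltr0n.
pose i0 := [arg min_(i < Ordinal n0) y t i 0]%O.
pose i1 := [arg max_(i > Ordinal n0) y t i 0]%O.
have ymm i : y t i0 0 <= y t i 0 <= y t i1 0.
  rewrite /i0 /i1; case: arg_minP => // a _ amin; case: arg_maxP => // b _ bmax.
  by apply/andP; split; [exact: amin | exact: bmax].
have [eq01|neq01] := eqVneq (y t i0 0) (y t i1 0).
  have d0 : dispersion (y t) = 0.
    rewrite /dispersion big1 // => i _; rewrite big1 // => j _.
    have := ymm i; have := ymm j; rewrite -eq01 => /le_anti <- /le_anti <-.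
    by rewrite subrr expr0n.
  by rewrite d0 mulr0 -d0; apply: dispersion_noninc.
have lt01 : y t i0 0 < y t i1 0.
  by rewrite lt_neqAle neq01; have /andP[] := ymm i0.
have [a [b [ya yb ba gap]]] := coordinate_gap ymm lt01.
have ab : a < b by rewrite -subr_gt0 ba divr_gt0 // subr_gt0.
pose S i := y t i 0 <= a.
have Sn i : ~~ S i -> b <= y t i 0.
  by rewrite /S => nS; have := gap i; rewrite (negbTE nS) /= => /ltW.
have : exists k, (k < Q.*2)%N && cut_crossed S (t + k).
  have [||k kQ kc] := @cut_crossing S t i0 i1 (leq_trans s1 st); rewrite ?/S //.
    by rewrite -ltNge (lt_le_trans ab).
  by exists k; rewrite kQ.
move=> /ex_minnP[k /andP[kQ kc] kmin].
(* before the first crossing, each side of the cut averages only within itself *)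
have inv l : (l <= k)%N ->
    forall i, (S i -> y (t + l) i 0 <= a) /\ (~~ S i -> b <= y (t + l) i 0).
  elim: l => [|l IH] lk i; first by rewrite addn0; split => // /Sn.
  have tl1 : (1 <= t + l)%N by apply: leq_trans s1 (leq_trans st (leq_addr l t)).
  have [[A0 Ar _] _ An] := AE tl1.
  have ncross j : S i != S j -> A (t + l)%N i j = 0.
    move=> Sij; apply: An; rewrite /in_neighbour negb_or; apply/andP; split.
      by apply: contraNneq Sij => ->.
    apply/negP => Eji; have cross : cut_crossed S (t + l).
      by apply/existsP; exists i; apply/existsP; exists j; rewrite Sij.
    by have := kmin l; rewrite (ltn_trans lk kQ) cross leqNgt lk => /(_ isT).
  rewrite addnS yS ?(leq_trans st) ?leq_addr // !mxE.
  have IHl := IH (ltnW lk).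
  split => Si.
    rewrite -[leRHS]mul1r -(Ar i) mulr_suml; apply: ler_sum => j _.
    have [Sj|Sj] := boolP (S j); first by rewrite ler_wpM2l //; apply IHl.
    by rewrite ncross ?mul0r // Si (negbTE Sj).
  rewrite -[leLHS]mul1r -(Ar i) mulr_suml; apply: ler_sum => j _.
  have [Sj|Sj] := boolP (S j); last by rewrite ler_wpM2l //; apply IHl.
  by rewrite ncross ?mul0r // (negbTE Si) Sj.
have tk1 : (1 <= t + k)%N by apply: leq_trans s1 (leq_trans st (leq_addr k t)).
have [dA Ap _] := AE tk1.
have drop : dispersion (y (t + k).+1) <= dispersion (y (t + k)) - n%:R * zeta * (b - a) ^+ 2.
  (* The crossing edge may point either way: the loss is symmetric in its endpoints, and the
     receiver [i] always gives weight to itself. *)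
  move: kc => /existsP[i /existsP[j /andP[Sij Eji]]].
  have tail := inv k (leqnn k).
  rewrite yS ?(leq_trans st) ?leq_addr //.
  apply: (le_trans (@dispersion_mulmx_drop _ _ zeta i j dA (ltW zeta0) _ _)).
  - by apply/ltW/Ap; rewrite /in_neighbour eqxx.
  - by apply/ltW/Ap; rewrite /in_neighbour Eji orbT.
  rewrite lerD2l lerN2 ler_wpM2l ?(mulr_ge0 _ (ltW zeta0)) //.
  have [ti ui] := tail i; have [tj uj] := tail j.
  have sq u v : u <= a -> b <= v -> (b - a) ^+ 2 <= (v - u) ^+ 2.
    by move=> ua bv; rewrite lerXn2r ?nnegrE ?subr_ge0 ?lerB // ?(ltW ab) // (le_trans ua) // (le_trans _ bv) // ltW.
  have [Si|Si] := boolP (S i); have [Sj|Sj] := boolP (S j).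
  - by rewrite Si Sj in Sij.
  - by rewrite -[X in _ <= X ^+ 2]opprB sqrrN; exact: sq (ti Si) (uj Sj).
  - exact: sq (tj Sj) (ui Si).
  - by rewrite (negbTE Si) (negbTE Sj) in Sij.
have le1 : dispersion (y (t + Q.*2)) <= dispersion (y (t + k).+1).
  have -> : (t + Q.*2 = (t + k).+1 + (Q.*2 - k.+1))%N by lia.
  by apply: dispersion_noninc; rewrite (leq_trans st) // -addnS leq_addr.
have le2 : dispersion (y (t + k)) <= dispersion (y t) by exact: dispersion_noninc.
have le3 : dispersion (y t) <= n%:R ^+ 2 * (y t i1 0 - y t i0 0) ^+ 2.
  apply: dispersion_le => i j.
  by have := ymm i; have := ymm j => /andP[? ?] /andP[? ?]; rewrite ler_norml; lra.
have -> : (1 - zeta / n%:R ^+ 3) * dispersion (y t)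
   = dispersion (y t) - zeta / n%:R ^+ 3 * dispersion (y t) by ring.
apply: (le_trans le1); apply: (le_trans drop); apply: lerB => //.
rewrite ba.
have -> : n%:R * zeta * ((y t i1 0 - y t i0 0) / n%:R) ^+ 2
  = zeta / n%:R ^+ 3 * (n%:R ^+ 2 * (y t i1 0 - y t i0 0) ^+ 2).
  by field; rewrite gt_eqF.
by rewrite ler_wpM2l // divr_ge0 ?exprn_ge0 ?ler0n // ltW.
Qed.

(* With r the square root of the dispersion, r (t + 2Q) <= (1 - q / 2) r t, so
   (q / 2) * sum of r telescopes. *)
Lemma sum_deviation T i j : zeta < 1 ->
  \sum_(s <= t < T) `|y t i 0 - y t j 0|
    <= 4 * Q%:R * n%:R ^+ 3 / zeta * Num.sqrt (dispersion (y s)).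
Proof.
move=> zeta1.
have n0 : (0 < n)%N by apply: leq_trans (ltn_ord i).
have n1 : 1 <= n%:R :> R by rewrite ler1n.
have n30 : 0 < n%:R ^+ 3 :> R by rewrite exprn_gt0 // (lt_le_trans ltr01).
pose r t := Num.sqrt (dispersion (y t)); set q := zeta / n%:R ^+ 3.
have q0 : 0 < q by rewrite divr_gt0.
have q1 : q <= 1.
  by rewrite ler_pdivrMr // mul1r (le_trans (ltW zeta1)) // exprn_ege1.
have r0 t : 0 <= r t by exact: sqrtr_ge0.
have rr t : r t ^+ 2 = dispersion (y t) by rewrite sqr_sqrtr // dispersion_ge0.
have rdec t : (s <= t)%N -> q / 2 * r t <= r t - r (t + Q.*2)%N.
  move=> st; rewrite lerBrDr -lerBrDl.
  rewrite -(@ler_pXn2r _ 2) ?nnegrE ?r0 //; last first.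
    by rewrite subr_ge0 ler_piMl // ; lra.
  rewrite rr (le_trans (dispersion_window st)) // -rr.
  by have := sqr_ge0 (q * r t); rewrite -/q; nra.
have rni t k : (s <= t)%N -> r (t + k)%N <= r t.
  by move=> st; rewrite ler_sqrt ?dispersion_ge0 // dispersion_noninc.
have dev : \sum_(s <= t < T) `|y t i 0 - y t j 0| <= \sum_(s <= t < T) r t.
  apply: ler_sum_nat => t /andP[st _].
  by rewrite -[leLHS]sqrtr_sqr ler_sqrt ?dispersion_ge0 // sqr_diff_le_dispersion.
apply: (le_trans dev).
(* [Phi t] sums [r] over a window of 2Q rounds, so the lagged difference r t - r (t + 2Q) becomes a
   genuine telescoping one, with total at most [Phi s] <= 2Q r s. *)
pose Phi t := \sum_(l < Q.*2) r (t + l)%N.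
have PhiS t : r t - r (t + Q.*2)%N = - (Phi t.+1 - Phi t).
  rewrite opprB /Phi; elim: (Q.*2) => [|k IH]; first by rewrite !big_ord0 addn0 !subrr.
  by rewrite !big_ord_recr /= opprD addrACA -IH addnS addSn; ring.
have Phi0 t : 0 <= Phi t by apply: sumr_ge0.
have [Ts|sT] := leqP T s.
  by rewrite big_geq // mulr_ge0 ?sqrtr_ge0 // divr_ge0 ?mulr_ge0 ?ler0n ?exprn_ge0 // ltW.
have main : q / 2 * \sum_(s <= t < T) r t <= 2 * Q%:R * r s.
  rewrite mulr_sumr.
  apply: (@le_trans _ _ (\sum_(s <= t < T) - (Phi t.+1 - Phi t))).
    by apply: ler_sum_nat => t /andP[st _]; rewrite -PhiS rdec.
  rewrite sumrN telescope_sumr ?(ltnW sT) // opprB (@le_trans _ _ (Phi s)) ?gerBl //.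
  have -> : 2 * Q%:R * r s = \sum_(l < Q.*2) r s.
    by rewrite sumr_const card_ord -[RHS]mulr_natl -muln2 natrM; ring.
  by apply: ler_sum => l _; exact: rni.
have -> : 4 * Q%:R * n%:R ^+ 3 / zeta * Num.sqrt (dispersion (y s)) =
  (2 * Q%:R * r s) / (q / 2).
  by rewrite /q /r; field; rewrite !gt_eqF //= (lt_le_trans ltr01).
by rewrite ler_pdivlMr ?divr_gt0 // mulrC.
Qed.

End Mixing.

(** * The window length against [net_Gamma] and [net_sigma] *)

Section NetworkConstants.
Context {R : realType}.
Variables (n Q : nat) (zeta : R).
Hypotheses (n0 : (0 < n)%N) (Q0 : (0 < Q)%N) (zeta01 : 0 < zeta < 1).

Let p : R := zeta / (4 * n%:R ^+ 2).

Let p01 : 0 < p <= 1 / 4.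
Proof.
have /andP[z0 z1] := zeta01.
have n1 : 1 <= n%:R ^+ 2 :> R by rewrite exprn_ege1 // ler1n.
rewrite /p; apply/andP; split; first by rewrite divr_gt0 // mulr_gt0 // (lt_le_trans ltr01).
by rewrite ler_pdivrMr; nra.
Qed.

Lemma net_sigma_lt1 : net_sigma n Q zeta < 1.
Proof.
have /andP[p0 p4] := p01.
rewrite /net_sigma -/p /powR gt_eqF; last by lra.
rewrite expR_lt1 pmulr_rlt0 ?divr_gt0 ?ltr0n // ln_lt0 //; lra.
Qed.

Lemma net_Gamma_ge1 : 1 <= net_Gamma n Q zeta.
Proof.
have /andP[p0 p4] := p01.
rewrite /net_Gamma -/p /powR gt_eqF; last by lra.
rewrite -[X in X <= _]expR0 ler_expR; apply: mulr_le0; last by apply: ln_le0; rewrite gerBl ltW.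
have Q1 : 1 <= Q%:R :> R by rewrite ler1n.
rewrite pmulr_lle0 ?invr_gt0 ?(lt_le_trans ltr01) //; lra.
Qed.

(** With p <= 1/4, ln (1 - p) >= -2p; together with e^x >= 1 + x this gives 1 - (1 - p)^(1/Q) <= 2p
    / Q. *)
Lemma net_sigma_gap : 1 - net_sigma n Q zeta <= zeta / (2 * n%:R ^+ 2 * Q%:R).
Proof.
have /andP[p0 p4] := p01.
have Q1 : 0 < Q%:R :> R by rewrite ltr0n.
have lnp : - (2 * p) <= ln (1 - p).
  rewrite lerNl -lnV ?posrE; last by lra.
  have -> : (1 - p)^-1 = 1 + p / (1 - p) by field; rewrite gt_eqF //; lra.
  apply: (le_trans (le_ln1Dx _)); last by rewrite ler_pdivrMr; nra.
  by rewrite (lt_trans (ltrN10 _)) // divr_gt0 //; lra.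
rewrite /net_sigma -/p /powR gt_eqF; last by lra.
apply: (@le_trans _ _ (2 * p / Q%:R)); last first.
  by rewrite le_eqVlt; apply/orP; left; apply/eqP; rewrite /p; field; rewrite !pnatr_eq0 -!lt0n ?n0 ?Q0.
rewrite lerBlDr -lerBlDl.
apply: (le_trans _ (expR_ge1Dx _)); rewrite lerD2l lerNl.
by rewrite mul1r -mulrN [leRHS]mulrC ler_wpM2l ?invr_ge0 ?ler0n // lerNl.
Qed.

(** The left side is, up to powers of n, the time scale of the window contraction. [net_Gamma]
    contributes only that it is at least 1, its base being below 1 and its exponent negative. *)
Lemma mixing_time_le : 2 * n%:R ^+ 2 * Q%:R / zeta
  <= net_Gamma n Q zeta / (1 - net_sigma n Q zeta).
Proof.
have /andP[z0 z1] := zeta01.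
have g0 : 0 < 1 - net_sigma n Q zeta by rewrite subr_gt0 net_sigma_lt1.
rewrite ler_pdivlMr //; apply: (le_trans _ net_Gamma_ge1).
have c0 : 0 < 2 * n%:R ^+ 2 * Q%:R / zeta :> R.
  by rewrite divr_gt0 // !mulr_gt0 // ?exprn_gt0 // ltr0n.
apply: (le_trans (ler_wpM2l (ltW c0) net_sigma_gap)).
rewrite le_eqVlt; apply/orP; left; apply/eqP; field.
by rewrite ?(gt_eqF z0) ?pnatr_eq0 -?lt0n ?n0 ?Q0.
Qed.

End NetworkConstants.

(** * Products of weight matrices *)

Section Transition.
Context {R : realType}.

(** The product A (s + k - 1) ... A s of [k] factors. The dimension is left free because it serves
    the weight matrices and the prediction matrices alike. *)
Fixpoint transition n (A : nat -> 'M[R]_n) (s k : nat) : 'M[R]_n :=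
  if k is k'.+1 then A (s + k')%N *m transition A s k' else 1%:M.

Lemma transition_row_sum n (A : nat -> 'M[R]_n) s k i :
  (forall t, (s <= t)%N -> doubly_stochastic (A t)) ->
  \sum_j transition A s k i j = 1.
Proof.
move=> dA; elim: k i => [|k IH] i /=.
  by rewrite (bigD1 i) //= big1 => [|j ji]; rewrite !mxE ?eqxx ?addr0 // eq_sym (negbTE ji).
under eq_bigr do rewrite mxE.
have [_ Ar _] := dA (s + k)%N (leq_addr _ _).
rewrite exchange_big /= -(Ar i); apply: eq_bigr => l _.
by rewrite -mulr_sumr IH mulr1.
Qed.

(** Column [l] of the products is the averaging iteration started at the unit vector [l], to which
    [sum_deviation] applies. *)
Lemma sum_transition_diff n zeta Q (E : nat -> rel 'I_n) (A : nat -> 'M[R]_n) s T i j l :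
  (0 < Q)%N -> 0 < zeta < 1 -> jointly_strongly_connected Q E ->
  (forall t, (1 <= t)%N -> weight_matrix zeta E t (A t)) -> (1 <= s)%N ->
  \sum_(s <= t < T) `|transition A s (t - s) i l - transition A s (t - s) j l|
    <= 4 * n%:R ^+ 2 * (net_Gamma n Q zeta / (1 - net_sigma n Q zeta)).
Proof.
move=> Q0 z01 jsc AE s1; have /andP[z0 z1] := z01.
have n0 : (0 < n)%N by apply: leq_trans (ltn_ord i).
pose y t := col l (transition A s (t - s)).
have yS t : (s <= t)%N -> y t.+1 = A t *m y t.
  by move=> st; rewrite /y subSn //= subnKC // !colE mulmxA.
(* For a unit vector n^2 is enough; (2n)^2 makes 4 Q n^3 / zeta times the root 2n exactly 4 n^2
   times the left side of [mixing_time_le]. *)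
have dys : dispersion (y s) <= (2 * n%:R) ^+ 2.
  have : dispersion (y s) <= n%:R ^+ 2 * 1 ^+ 2.
    apply: dispersion_le => a b; rewrite /y subnn !mxE.
    by do 2 case: (_ == _); rewrite ?subrr ?subr0 ?sub0r ?normrN ?normr0 ?normr1 ?ler01.
  have : 0 <= n%:R :> R by []; nra.
have := @sum_deviation R n zeta Q E A z0 AE Q0 jsc s y s1 yS T i j z1.
rewrite (eq_big_nat _ _ (F2 := fun t =>
   `|transition A s (t - s) i l - transition A s (t - s) j l|)); last first.
  by move=> t _; rewrite !mxE.
move=> /le_trans; apply.
have n3 : 0 <= 4 * Q%:R * n%:R ^+ 3 / zeta by rewrite divr_ge0 ?mulr_ge0 ?exprn_ge0 // ltW.
apply: (@le_trans _ _ (4 * Q%:R * n%:R ^+ 3 / zeta * (2 * n%:R))).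
  rewrite ler_wpM2l // -[leRHS]ger0_norm ?mulr_ge0 // -sqrtr_sqr.
  by rewrite ler_sqrt ?sqr_ge0.
apply: (@le_trans _ _ (4 * n%:R ^+ 2 * (2 * n%:R ^+ 2 * Q%:R / zeta))).
  by rewrite le_eqVlt; apply/orP; left; apply/eqP; ring.
by rewrite ler_wpM2l ?mulr_ge0 ?exprn_ge0 // mixing_time_le.
Qed.

End Transition.

(** * Norms, gradients and mirror steps *)

Section Norms.
Context {R : realType} {d : nat}.
Variable N : 'cV[R]_d -> R.
Hypothesis nN : is_norm N.
Implicit Types u v : 'cV[R]_d.

Lemma is_normD u v : N (u + v) <= N u + N v.
Proof. by case: nN. Qed.

Lemma is_normZ a u : N (a *: u) = `|a| * N u.
Proof. by case: nN. Qed.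

Lemma is_norm0 : N 0 = 0.
Proof. by rewrite -(scale0r 0) is_normZ normr0 mul0r. Qed.

Lemma is_normN u : N (- u) = N u.
Proof. by rewrite -scaleN1r is_normZ normrN normr1 mul1r. Qed.

Lemma is_norm_ge0 u : 0 <= N u.
Proof.
have := is_normD u (- u); rewrite subrr is_norm0 is_normN; lra.
Qed.

Lemma is_norm_sub u v : N (u - v) = N (v - u).
Proof. by rewrite -is_normN opprB. Qed.

Lemma is_norm_eq0 u : N u = 0 -> u = 0.
Proof. by case: nN => _ _; apply. Qed.

Lemma is_norm_sum (I : Type) (s : seq I) (P : pred I) (F : I -> 'cV[R]_d) :
  N (\sum_(i <- s | P i) F i) <= \sum_(i <- s | P i) N (F i).
Proof.
elim/big_ind2 : _ => [|x a y b xa yb|//]; first by rewrite is_norm0.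
by apply: (le_trans (is_normD _ _)); rewrite lerD.
Qed.

Lemma col_decomp u : u = \sum_k u k 0 *: delta_mx k 0.
Proof.
apply/colP => i; rewrite summxE (bigD1 i) //= big1 => [|j ji]; rewrite !mxE ?eqxx.
  by rewrite mulr1 addr0.
by rewrite eq_sym (negbTE ji) mulr0.
Qed.

Lemma is_norm_le_coord u : N u <= \sum_k `|u k 0| * N (delta_mx k 0).
Proof.
rewrite {1}(col_decomp u); apply: (le_trans (is_norm_sum _ _ _)).
by apply: ler_sum => k _; rewrite is_normZ.
Qed.

Lemma rV_coord_le_norm (r : 'rV[R]_d) k : `|r 0 k| <= `|r|.
Proof.
have /mapP[j Hj ->] : `|r 0 k| \in [seq `|r x.1 x.2| | x : 'I_1 * 'I_d].
  by apply/mapP; exists (0, k) => //=; rewrite mem_enum.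
by rewrite [leRHS]/Num.norm /= mx_normrE; apply/bigmax_geP; right => /=; exists j.
Qed.

(* The minimum of N on the unit sphere of the sup norm is positive. *)
Lemma coord_le_is_norm : exists2 c, 0 <= c & forall u k, `|u k 0| <= c * N u.
Proof.
have [d0|d0] := posnP d.
  by exists 0 => // u k; have := ltn_ord k; lia.
pose f (r : 'rV[R]_d) := N r^T.
pose c := \sum_k N (delta_mx k 0).
have c0 : 0 <= c by apply: sumr_ge0 => k _; exact: is_norm_ge0.
have fle r : f r <= c * `|r|.
  apply: (le_trans (is_norm_le_coord _)); rewrite /c mulr_suml.
  apply: ler_sum => k _; rewrite mxE mulrC ler_wpM2l ?is_norm_ge0 //.
  exact: rV_coord_le_norm.
have fsub r s : `|f r - f s| <= c * `|r - s|.
  have fB r' s' : f r' - f s' <= f (r' - s').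
    by rewrite lerBlDr /f (le_trans _ (is_normD _ _)) // -linearD /= subrK.
  rewrite ler_norml lerNl opprB; apply/andP; split.
    by rewrite distrC (le_trans (fB _ _)).
  by rewrite (le_trans (fB _ _)).
have fcont : continuous f.
  move=> r; apply/(@cvgrPdist_le _ _ _ (nbhs r) (nbhs_filter r)) => e e0.
  near=> s; apply: (le_trans (fsub _ _)).
  apply: (@le_trans _ _ ((c + 1) * `|r - s|)); first by rewrite ler_wpM2r ?normr_ge0 ?lerDl.
  rewrite mulrC -ler_pdivlMr; last by lra.
  near: s; move/(@cvgrPdist_le _ _ _ (nbhs r) (nbhs_filter r)): (@cvg_id _ (nbhs r)); apply; rewrite divr_gt0 //; lra.
pose A := [set r : 'rV[R]_d | `|r| = 1].
have Acpt : compact A.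
  apply: bounded_closed_compact.
    by exists 1; split => // x x1 r /= ->; rewrite ltW.
  apply: (@preimage_closed _ _ (fun r : 'rV[R]_d => `|r|) [set 1]); last exact: closed_eq.
  by move=> ? _; exact: norm_continuous.
have A0 : A !=set0.
  pose r : 'rV[R]_d := const_mx 1.
  exists (`|r|^-1 *: r); rewrite /A /= normrZ normfV normr_id mulVf // normr_eq0.
  apply/eqP => /rowP /(_ (Ordinal d0)) /eqP; rewrite !mxE oner_eq0 //.
have [r0 r0A r0min] := compact_EVT_min A0 Acpt (continuous_subspaceT fcont).
have f0 : 0 < f r0.
  rewrite lt_neqAle is_norm_ge0 andbT eq_sym; apply/eqP => /is_norm_eq0 /(congr1 trmx).
  rewrite trmxK trmx0 => r00; move: r0A; rewrite inE /A /= r00 normr0 => /eqP.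
  by rewrite eq_sym oner_eq0.
exists (f r0)^-1; first by rewrite invr_ge0 ltW.
move=> u k; rewrite mulrC ler_pdivlMr //.
have [->|u0] := eqVneq u 0; first by rewrite mxE normr0 mul0r is_norm_ge0.
have ut0 : 0 < `|u^T| by rewrite normr_gt0; apply: contraNneq u0 => /(congr1 trmx); rewrite trmxK trmx0 => ->.
have /r0min : `|u^T|^-1 *: u^T \in A.
  by rewrite inE /A /= normrZ normfV normr_id mulVf ?gt_eqF.
rewrite {2}/f linearZ /= trmxK is_normZ normfV normr_id => f1.
apply: (@le_trans _ _ (`|u^T| * f r0)).
  rewrite ler_wpM2r ?(ltW f0) //; have := rV_coord_le_norm u^T k; by rewrite mxE.
by rewrite mulrC -ler_pdivlMr // mulrC.
Unshelve. all: by end_near. Qed.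

(** [dual_norm] is a [sup], informative only for a set bounded above; [coord_le_is_norm] provides
    the bound. The same concern governs [dual_norm_ge0] and [op_norm_le]. *)
Lemma inner_le_dual u v : inner u v <= dual_norm N u * N v.
Proof.
have [c c0 cN] := coord_le_is_norm.
have [/is_norm_eq0 ->|v0] := eqVneq (N v) 0.
  by rewrite is_norm0 mulr0 /inner big1 // => k _; rewrite mxE mulr0.
have {}v0 : 0 < N v by rewrite lt_neqAle eq_sym v0 is_norm_ge0.
rewrite -ler_pdivrMr //.
have -> : inner u v / N v = inner u ((N v)^-1 *: v).
  by rewrite /inner mulr_suml; apply: eq_bigr => k _; rewrite mxE mulrCA -mulrA; ring.
apply: ub_le_sup; last first.
  by exists ((N v)^-1 *: v) => //=; rewrite is_normZ ger0_norm ?invr_ge0 ?(ltW v0) // mulVf ?gt_eqF.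
exists (\sum_k `|u k 0| * c) => _ [w /= w1 <-].
apply: ler_sum => k _; apply: (le_trans (ler_norm _)); rewrite normrM ler_wpM2l //.
by apply: (le_trans (cN _ _)); rewrite ler_piMr.
Qed.

Lemma dual_norm_ge0 u : 0 <= dual_norm N u.
Proof.
have [c c0 cN] := coord_le_is_norm.
apply: ub_le_sup; last by exists 0; rewrite /= ?is_norm0 // /inner big1 // => k _; rewrite mxE mulr0.
exists (\sum_k `|u k 0| * c) => _ [w /= w1 <-].
apply: ler_sum => k _; apply: (le_trans (ler_norm _)); rewrite normrM ler_wpM2l //.
by apply: (le_trans (cN _ _)); rewrite ler_piMr.
Qed.

Lemma op_norm_le (B : 'M[R]_d) v : op_norm N B <= 1 -> N (B *m v) <= N v.
Proof.
move=> B1; have [c c0 cN] := coord_le_is_norm.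
have [/is_norm_eq0 ->|v0] := eqVneq (N v) 0; first by rewrite mulmx0 is_norm0.
have {}v0 : 0 < N v by rewrite lt_neqAle eq_sym v0 is_norm_ge0.
rewrite -[leRHS]mul1r -ler_pdivrMr //; apply: le_trans B1.
have -> : N (B *m v) / N v = N (B *m ((N v)^-1 *: v)).
  by rewrite -scalemxAr is_normZ ger0_norm ?invr_ge0 ?(ltW v0) // mulrC.
apply: ub_le_sup; last first.
  by exists ((N v)^-1 *: v) => //=; rewrite is_normZ ger0_norm ?invr_ge0 ?(ltW v0) // mulVf ?gt_eqF.
exists (\sum_k c * N (B *m delta_mx k 0)) => _ [w /= w1 <-].
rewrite {1}(col_decomp w) mulmx_sumr; apply: (le_trans (is_norm_sum _ _ _)).
apply: ler_sum => k _; rewrite -scalemxAr is_normZ ler_wpM2r ?is_norm_ge0 //.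
by apply: (le_trans (cN _ _)); rewrite ler_piMr.
Qed.

End Norms.

Section Inner.
Context {R : realType} {d : nat}.
Implicit Types u v w : 'cV[R]_d.

Lemma innerDl u v w : inner (u + v) w = inner u w + inner v w.
Proof. by rewrite -big_split; apply: eq_bigr => k _; rewrite mxE mulrDl. Qed.

Lemma innerDr u v w : inner w (u + v) = inner w u + inner w v.
Proof. by rewrite -big_split; apply: eq_bigr => k _; rewrite mxE mulrDr. Qed.

Lemma innerZl a u w : inner (a *: u) w = a * inner u w.
Proof. by rewrite /inner mulr_sumr; apply: eq_bigr => k _; rewrite mxE mulrA. Qed.

Lemma innerZr a u w : inner w (a *: u) = a * inner w u.
Proof. by rewrite /inner mulr_sumr; apply: eq_bigr => k _; rewrite mxE mulrCA. Qed.

Lemma innerNl u w : inner (- u) w = - inner u w.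
Proof. by rewrite -scaleN1r innerZl mulN1r. Qed.

Lemma innerNr u w : inner w (- u) = - inner w u.
Proof. by rewrite -scaleN1r innerZr mulN1r. Qed.

Lemma innerBl u v w : inner (u - v) w = inner u w - inner v w.
Proof. by rewrite innerDl innerNl. Qed.

Lemma innerBr u v w : inner w (u - v) = inner w u - inner w v.
Proof. by rewrite innerDr innerNr. Qed.

End Inner.

(** * Gradients, Bregman divergences and the mirror step *)

Section Gradient.
Context {R : realType} {d : nat}.
Implicit Types (g : 'cV[R]_d -> R^o) (a b v : 'cV[R]_d).

Lemma derive_gradient g b v : differentiable g b ->
  'D_v g b = inner (gradient g b) v.
Proof.
move=> dg; rewrite deriveE // {1}(col_decomp v) linear_sum /=.
apply: eq_bigr => k _; rewrite linearZ /= mxE deriveE //.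
by rewrite [LHS]mulrC.
Qed.

Lemma gradientN g b : differentiable g b ->
  gradient (fun x => - g x : R^o) b = - gradient g b.
Proof.
move=> dg; apply/colP => k; rewrite !mxE.
by rewrite -deriveN //; apply: diff_derivable.
Qed.

(** The limit of the difference quotient is tested at positive steps only, so a one-sided estimate
    suffices. The quadratic remainder is there for strong convexity. *)
Lemma derive_le g b v c c' : derivable g b v ->
  (forall s, 0 < s <= 1 -> g (s *: v + b) - g b <= s * c + s ^+ 2 * c') ->
  'D_v g b <= c.
Proof.
move=> dg gle; apply/ler_addgt0Pr => e e0.
have e20 : 0 < e / 2 by rewrite divr_gt0.
move: dg => /cvgrPdist_le /(_ _ e20) /nbhs_ballP[r /= r0 rP].
set D := 'D_v g b in rP *.
(* [s] lies within the radius [r] where the quotient is e/2-close to the derivative, and is so small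
   that the remainder costs at most another e/2. *)
pose s := Num.min (r / 2) (Num.min 1 (e / 2 / (`|c'| + 1))).
have c10 : 0 < `|c'| + 1 by rewrite ltr_pwDr.
have s0 : 0 < s by rewrite !lt_min ?divr_gt0 ?ltr01.
have s1 : s <= 1 by rewrite !ge_min lexx orbT.
have sr : s < r by rewrite !gt_min; apply/orP; left; lra.
have sc : s * `|c'| <= e / 2.
  apply: (@le_trans _ _ (s * (`|c'| + 1))); first by rewrite ler_wpM2l ?lerDl // ltW.
  by rewrite -ler_pdivlMr // !ge_min lexx !orbT.
have := rP s; rewrite /ball /= sub0r normrN gtr0_norm // => /(_ sr).
rewrite gt_eqF // => /(_ isT); rewrite ler_norml => /andP[_].
have : s^-1 *: (g (s *: v + b) - g b) <= c + s * `|c'|.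
  rewrite /GRing.scale /= mulrC ler_pdivrMr // (le_trans (gle _ _)) ?s0 //.
  have -> : (c + s * `|c'|) * s = s * c + s ^+ 2 * `|c'| by ring.
  by rewrite lerD2l ler_wpM2l ?sqr_ge0 // ler_norm.
rewrite /D /derive /= /GRing.scale /=; lra.
Qed.

Lemma le_derive g b v c : differentiable g b ->
  (forall s, 0 < s <= 1 -> s * c <= g (s *: v + b) - g b) ->
  c <= inner (gradient g b) v.
Proof.
move=> dg gle; rewrite -lerN2 -innerNl -gradientN // -derive_gradient; last exact: differentiableN.
apply: (@derive_le _ _ _ _ 0); first by apply: diff_derivable; exact: differentiableN.
move=> s s01; have := gle s s01; rewrite mulr0 addr0 mulrN; lra.
Qed.

Lemma convex_set_segment (X : set 'cV[R]_d) a b s : convex_set X -> X a -> X b ->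
  0 <= s <= 1 -> X (s *: (a - b) + b).
Proof.
move=> cX /mem_set Xa /mem_set Xb /andP[s0 s1].
have /set_mem := cX a b (Itv01 s0 s1) Xa Xb.
congr X; rewrite /conv /= /mathcomp.classical.unstable.onem scalerBl scale1r scalerBr -addrA; congr (_ + _).
by rewrite addrC.
Qed.

Lemma convex_function_gradient g a b : convex_function setT g ->
  differentiable g b -> inner (gradient g b) (a - b) <= g a - g b.
Proof.
move=> cg dg; rewrite -derive_gradient //.
apply: (@derive_le _ _ _ _ 0); first exact: diff_derivable.
move=> s /andP[s0 s1].
have := cg (Itv01 (ltW s0) s1) a b (in_setT _) (in_setT _).
have -> : s *: (a - b) + b = s *: a + (1 - s) *: b.
  by rewrite scalerBl scale1r scalerBr -addrA; congr (_ + _); rewrite addrC.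
rewrite [X in _ <= X]convRE /conv /= /mathcomp.classical.unstable.onem; lra.
Qed.

Variables (N : 'cV[R]_d -> R) (X : set 'cV[R]_d) (rho : R) (g : 'cV[R]_d -> R).
Hypotheses (nN : is_norm N) (rho0 : 0 < rho) (convX : convex_set X).
Hypothesis dg : forall x, differentiable (g : 'cV[R]_d -> R^o) x.
Hypothesis scg : strongly_convex_on N X rho g.

Lemma bregman_lower a b : X a -> X b -> rho / 2 * N (a - b) ^+ 2 <= bregman g a b.
Proof.
move=> Xa Xb; rewrite /bregman -derive_gradient //.
suff : 'D_(a - b) (g : _ -> R^o) b <= g a - g b - rho / 2 * N (a - b) ^+ 2 by lra.
(* The term rho/2 s (1 - s) N^2 of strong convexity splits into a first-order gain and a remainder
   of order s^2, whose coefficient is passed here. *)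
apply: (@derive_le _ _ _ _ (rho / 2 * N (a - b) ^+ 2)); first exact: diff_derivable.
move=> s /andP[s0 s1].
have := scg Xa Xb (s := s); rewrite (ltW s0) s1 => /(_ isT).
have -> : s *: (a - b) + b = s *: a + (1 - s) *: b.
  by rewrite scalerBl scale1r scalerBr -addrA; congr (_ + _); rewrite addrC.
by rewrite expr2; lra.
Qed.

Lemma bregman_ge0 a b : X a -> X b -> 0 <= bregman g a b.
Proof.
move=> Xa Xb; apply: le_trans (bregman_lower Xa Xb).
by rewrite mulr_ge0 ?sqr_ge0 // divr_ge0 // ltW.
Qed.

(** First-order condition of the Bregman projection: along the segment from [xt] to [x] the
    divergence from [z] never falls below its value at [xt]. The point [z] may lie outside [X] and
    enters through its gradient. *)
Lemma argmin_bregman_optimality z xt x :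
  is_argmin_on X (fun y => bregman g y z) xt -> X x ->
  inner (gradient g z) (x - xt) <= inner (gradient g xt) (x - xt).
Proof.
move=> [Xt tmin] Xx; apply: le_derive => // s /andP[s0 s1].
have Xs : X (s *: (x - xt) + xt) by apply: convex_set_segment; rewrite ?(ltW s0).
have := tmin _ Xs; rewrite /bregman !(innerBr, innerDr, innerZr); lra.
Qed.

Lemma bregman_three_points a x xt :
  bregman g a x - bregman g a xt - bregman g xt x
  = inner (gradient g xt - gradient g x) (a - xt).
Proof. rewrite /bregman innerBl !innerBr; ring. Qed.

Section MirrorStep.
Variables (alpha : R) (G x z xt : 'cV[R]_d).
Hypotheses (alpha0 : 0 < alpha) (Xx : X x).
Hypothesis zE : gradient g z = gradient g x - alpha *: G.
Hypothesis xtP : is_argmin_on X (fun y => bregman g y z) xt.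

(** Optimality is tested against the starting point [x] itself. The two divergences between [x] and
    [xt] add up to at least rho u^2, with u their distance, and to at most alpha <G, x - xt> <=
    alpha D u, with D the dual norm of [G]. *)
Lemma mirror_step_displacement : rho * N (x - xt) <= alpha * dual_norm N G.
Proof.
have Xt : X xt by case: xtP.
have := argmin_bregman_optimality xtP Xx; rewrite zE innerBl innerZl.
have := bregman_three_points x x xt; rewrite innerBl.
have -> : bregman g x x = 0 by rewrite /bregman !subrr /inner big1 ?subr0 // => k _; rewrite !mxE mulr0.
have := bregman_lower Xx Xt; have := bregman_lower Xt Xx.
rewrite (is_norm_sub nN xt x).
have := inner_le_dual nN G (x - xt); have := is_norm_ge0 nN (x - xt).
have := dual_norm_ge0 nN G.
move: (N _) (dual_norm _ _) (inner G _) => u D i D0 u0 iD b1 b2 e1 e2.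
have [->|u1] := eqVneq u 0; first by rewrite mulr0 mulr_ge0 // ltW.
have {u1}u0 : 0 < u by rewrite lt_neqAle eq_sym u1.
rewrite -(ler_pM2r u0) -!mulrA; apply: (@le_trans _ _ (alpha * i)); first by nra.
by rewrite ler_wpM2l // ltW.
Qed.

(** Optimality against [a] and the three-point identity leave alpha <G, x - xt> minus the divergence
    of [xt] from [x]; Young's inequality bounds this by alpha^2 D^2 / (2 rho). *)
Lemma mirror_step a : X a ->
  alpha * inner G (x - a) <= bregman g a x - bregman g a xt
    + alpha ^+ 2 / (2 * rho) * dual_norm N G ^+ 2.
Proof.
move=> Xa; have Xt : X xt by case: xtP.
have := argmin_bregman_optimality xtP Xa; rewrite zE innerBl innerZl.
have := bregman_three_points a x xt; rewrite innerBl.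
have := bregman_lower Xt Xx; rewrite (is_norm_sub nN xt x).
have := inner_le_dual nN G (x - xt).
have -> : inner G (x - a) = inner G (x - xt) - inner G (a - xt) by rewrite !innerBr; ring.
move: (N _) (dual_norm _ _) (inner G (x - xt)) => u D i iD b1 e1 e2.
have amgm : alpha * (D * u) - rho / 2 * u ^+ 2 <= alpha ^+ 2 / (2 * rho) * D ^+ 2.
  rewrite -subr_ge0.
  have -> : alpha ^+ 2 / (2 * rho) * D ^+ 2 - (alpha * (D * u) - rho / 2 * u ^+ 2) =
    (alpha * D - rho * u) ^+ 2 / (2 * rho) by field; rewrite gt_eqF.
  by rewrite divr_ge0 ?sqr_ge0 // mulr_ge0 // ltW.
have : alpha * i <= alpha * (D * u) by rewrite ler_wpM2l // ltW.
lra.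
Qed.

End MirrorStep.
End Gradient.

(** * Disagreement and regret along a path *)

Section Pathwise.
Context {R : realType} {n d : nat}.
Variables (zeta : R) (Q : nat) (E : nat -> rel 'I_n) (A : nat -> 'M[R]_n).
Hypotheses (Q0 : (0 < Q)%N) (zeta01 : 0 < zeta < 1).
Hypothesis jsc : jointly_strongly_connected Q E.
Hypothesis AE : forall t, (1 <= t)%N -> weight_matrix zeta E t (A t).

Let dA t : (1 <= t)%N -> doubly_stochastic (A t).
Proof. by move=> t1; case: (AE t1). Qed.

Lemma convex_set_sum (X : set 'cV[R]_d) k (p : 'I_k -> R) (v : 'I_k -> 'cV[R]_d) :
  convex_set X -> (forall i, 0 <= p i) -> \sum_i p i = 1 -> (forall i, X (v i)) ->
  X (\sum_i p i *: v i).
Proof.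
move=> cX; elim: k p v => [|k IH] p v p0 p1 Xv.
  by move: p1; rewrite big_ord0 => /eqP; rewrite eq_sym oner_eq0.
rewrite big_ord_recr /=; move: p1; rewrite big_ord_recr /=.
set q := \sum_(i < k) _ => qp.
have q0 : 0 <= q by apply: sumr_ge0.
have [q00|q00] := eqVneq q 0.
  have /eqP := q00; rewrite psumr_eq0 // => /allP pz.
  rewrite big1 => [|i _].
    by move: qp; rewrite q00 !add0r => ->; rewrite scale1r.
  by have /eqP -> := pz i (mem_index_enum i); rewrite scale0r.
have qgt : 0 < q by rewrite lt_neqAle eq_sym q00.
have Xm : X (\sum_(i < k) (p (widen_ord (leqnSn k) i) / q) *: v (widen_ord (leqnSn k) i)).
  apply: IH => // [i|]; first by rewrite divr_ge0.
  by rewrite -mulr_suml mulfV.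
have := @convex_set_segment _ _ _ _ _ q cX Xm (Xv ord_max); rewrite q0 /=.
have -> : q <= 1 by rewrite -qp lerDl.
move=> /(_ isT); congr X; rewrite scalerBr addrAC -addrA; congr (_ + _).
  by rewrite scaler_sumr; apply: eq_bigr => i _; rewrite scalerA mulrCA mulfV ?mulr1.
by rewrite -scaleNr -[X in X + _]scale1r -scalerDl -qp addrAC subrr add0r.
Qed.

Lemma neighbour_sum (v : 'I_n -> 'cV[R]_d) t i : (1 <= t)%N ->
  \sum_(j | in_neighbour E t i j) A t i j *: v j = \sum_j A t i j *: v j.
Proof.
move=> t1; rewrite [RHS](bigID (in_neighbour E t i)) /= [X in _ + X]big1 ?addr0 // => j nij.
by have [_ _ An] := AE t1; rewrite An // scale0r.
Qed.

Variables (N : 'cV[R]_d -> R) (X : set 'cV[R]_d) (g : 'cV[R]_d -> R).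
Hypotheses (nN : is_norm N) (convX : convex_set X).
Variables (B : nat -> 'M[R]_d) (T : nat).
Hypothesis BX : forall t, (1 <= t <= T)%N -> admissible_prediction N X g (B t).
Variables (x xt : nat -> 'I_n -> 'cV[R]_d).
Hypothesis x1X : forall i, X (x 1%N i).
Hypothesis xtX : forall t i, (1 <= t <= T)%N -> X (xt t i).
Hypothesis xS : forall t i, (1 <= t <= T)%N ->
  x t.+1 i = \sum_(j | in_neighbour E t i j) A t i j *: (B t *m xt t j).

Lemma decision_in t i : (1 <= t <= T.+1)%N -> X (x t i).
Proof.
case: t => // -[|t] tT //; rewrite xS // neighbour_sum //.
have [A0 Ar _] := dA (ltn0Sn t).
by apply: convex_set_sum => // j; case: (BX (t := t.+1)) => // _ _; apply; apply: xtX.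
Qed.

(* The state at time t of the noiseless iteration that starts from v at time s. *)
Definition evolve s t (v : 'I_n -> 'cV[R]_d) i :=
  \sum_l transition A s (t - s) i l *: (transition B s (t - s) *m v l).

Lemma evolve_refl s v i : evolve s s v i = v i.
Proof.
rewrite /evolve subnn (bigD1 i) //= big1 => [|l li]; rewrite mxE mul1mx.
  by rewrite eqxx scale1r addr0.
by rewrite eq_sym (negbTE li) scale0r.
Qed.

Lemma evolveS s t v i : (s <= t)%N ->
  evolve s t.+1 v i = \sum_j A t i j *: (B t *m evolve s t v j).
Proof.
move=> st; rewrite /evolve subSn //= subnKC //.
under [RHS]eq_bigr do rewrite mulmx_sumr scaler_sumr.
rewrite exchange_big /=; apply: eq_bigr => l _.
rewrite mxE scaler_suml; apply: eq_bigr => j _.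
by rewrite -scalemxAr scalerA mulmxA.
Qed.

(** Variation of constants: [xt] is [x] plus a displacement, so each round is the linear iteration
    with the displacement of that round as a new source. *)
Lemma evolve_superposition t i : (1 <= t <= T.+1)%N ->
  x t i = evolve 1 t (x 1%N) i
    + \sum_(1 <= s < t) evolve s t (fun l => xt s l - x s l) i.
Proof.
elim: t i => // -[|t] IH i tT; first by rewrite evolve_refl big_geq // addr0.
have {}IH j : x t.+1 j = _ := IH j (ltnW tT).
rewrite xS // neighbour_sum // big_nat_recr //= evolveS //.
rewrite (evolveS _ _ (leqnn t.+1)).
rewrite (eq_big_nat _ _ (F2 := fun s => \sum_j A t.+1 i j *:
    (B t.+1 *m evolve s t.+1 (fun l => xt s l - x s l) j))); last first.
  by move=> s /andP[_ st]; rewrite evolveS // ltnW.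
rewrite exchange_big /= addrA -!big_split /=; apply: eq_bigr => j _.
rewrite -scaler_sumr -mulmx_sumr -!scalerDr -!mulmxDr evolve_refl -IH.
by rewrite addrC subrK.
Qed.

Lemma transition_nonexpansive s k v : (1 <= s)%N -> (s + k <= T.+1)%N ->
  N (transition B s k *m v) <= N v.
Proof.
move=> s1; elim: k => [|k IH] skT /=; first by rewrite mul1mx.
rewrite -mulmxA; apply: (le_trans _ (IH _)); last by lia.
by apply: op_norm_le => //; case: (BX (t := (s + k)%N)) => //; lia.
Qed.

(** Rows of the weight products sum to 1, so a common offset [c] reaches all agents as the same
    vector and cancels. It is taken as [x 1 j] for the initial decisions and as 0 for the
    displacements. *)
Lemma evolve_diff s t v i j c : (1 <= s <= t)%N -> (t <= T.+1)%N ->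
  N (evolve s t v i - evolve s t v j)
  <= \sum_l `|transition A s (t - s) i l - transition A s (t - s) j l| * N (v l - c).
Proof.
move=> /andP[s1 st] tT.
have dAs u : (s <= u)%N -> doubly_stochastic (A u) by move=> su; apply: dA; lia.
have shift k : evolve s t v k = evolve s t (fun l => v l - c) k + transition B s (t - s) *m c.
  rewrite /evolve -[X in _ + X]scale1r -(transition_row_sum (t - s) k dAs) scaler_suml.
  by rewrite -big_split /=; apply: eq_bigr => l _; rewrite -scalerDr -mulmxDr subrK.
rewrite !shift opprD addrACA subrr addr0 /evolve -sumrB; apply: (le_trans (is_norm_sum nN _ _ _)).
apply: ler_sum => l _; rewrite -scalerBl is_normZ // ler_wpM2l //.
by apply: transition_nonexpansive => //; lia.
Qed.

Let M := 4 * n%:R ^+ 2 * (net_Gamma n Q zeta / (1 - net_sigma n Q zeta)).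

Lemma sum_disagreement i j :
  \sum_(1 <= t < T.+1) N (x t i - x t j)
  <= M * (\sum_l N (x 1%N l - x 1%N j)
          + \sum_(1 <= s < T.+1) \sum_l N (xt s l - x s l)).
Proof.
pose w s t l := `|transition A s (t - s) i l - transition A s (t - s) j l|.
have wM s l : (1 <= s)%N -> \sum_(s <= t < T.+1) w s t l <= M.
  by move=> s1; exact: (sum_transition_diff _ _ _ _ Q0 zeta01 jsc AE).
have w0 s t l : 0 <= w s t l by exact: normr_ge0.
apply: (@le_trans _ _ (\sum_(1 <= t < T.+1)
   (\sum_l w 1%N t l * N (x 1%N l - x 1%N j)
    + \sum_(1 <= s < t) \sum_l w s t l * N (xt s l - x s l)))).
  apply: ler_sum_nat => t /andP[t1 tT].
  have t1T : (1 <= t <= T.+1)%N by lia.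
  rewrite (evolve_superposition i t1T) (evolve_superposition j t1T) opprD addrACA.
  apply: (le_trans (is_normD nN _ _)); apply: lerD.
    by apply: (@evolve_diff 1 t (x 1%N) i j (x 1%N j)); lia.
  rewrite -sumrB; apply: (le_trans (is_norm_sum nN _ _ _)).
  apply: ler_sum_nat => s /andP[s1 st].
  apply: (le_trans (@evolve_diff s t _ i j 0 _ _)); [lia | lia |].
  by apply: ler_sum => l _; rewrite subr0.
rewrite big_split mulrDr /=; apply: lerD.
  rewrite exchange_big mulr_sumr /=; apply: ler_sum => l _.
  by rewrite -mulr_suml ler_wpM2r ?is_norm_ge0 // wM.
(* The inner range is extended to the horizon under the condition [s < t], so that the sums can be
   exchanged; the term [t = s] is added afterwards, as [wM] starts there. *)
rewrite (eq_big_nat _ _ (F2 := fun t => \sum_(1 <= s < T.+1 | (s < t)%N)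
    \sum_l w s t l * N (xt s l - x s l))); last first.
  by move=> t /andP[_ tT]; rewrite (big_nat_widen _ _ T.+1) //; lia.
rewrite (exchange_big_dep_nat xpredT) //= mulr_sumr.
apply: ler_sum_nat => s /andP[s1 sT].
apply: (@le_trans _ _ (\sum_(s <= t < T.+1) \sum_l w s t l * N (xt s l - x s l))).
  have -> : \sum_(1 <= t < T.+1 | (s < t)%N) \sum_l w s t l * N (xt s l - x s l) =
      \sum_(s.+1 <= t < T.+1) \sum_l w s t l * N (xt s l - x s l).
    by rewrite [RHS](big_nat_widenl _ 1).
  rewrite [leRHS]big_ltn // lerDr sumr_ge0 // => l _.
  by rewrite mulr_ge0 ?is_norm_ge0.
rewrite exchange_big mulr_sumr /=; apply: ler_sum => l _.
by rewrite -mulr_suml ler_wpM2r ?is_norm_ge0 // wM.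
Qed.

Variables (rho K MX : R).
Hypotheses (rho0 : 0 < rho).
Hypothesis XM : forall a b, X a -> X b -> N (a - b) <= MX.
Hypothesis dg : forall a, differentiable (g : 'cV[R]_d -> R^o) a.
Hypothesis scg : strongly_convex_on N X rho g.
Hypothesis lipg : bregman_lipschitz N X g K.
Hypothesis convg : bregman_separately_convex n g.

Lemma bregman_le_max a b : X a -> X b -> bregman g a b <= bregman_max g X.
Proof.
move=> Xa Xb; apply: ub_le_sup; last by exists (a, b).
(* The absolute value covers a constant [K] of unknown sign. *)
exists (`|K| * MX) => _ [[u v] [/= Xu Xv] <-].
have bvv : bregman g v v = 0.
  by rewrite /bregman !subrr /inner big1 ?subr0 // => k _; rewrite !mxE mulr0.
have := lipg Xu Xv Xv; rewrite bvv subr0 => h.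
apply: (le_trans (ler_norm _)); apply: (le_trans h).
apply: (@le_trans _ _ (`|K| * N (u - v))); first by rewrite ler_wpM2r ?is_norm_ge0 ?ler_norm.
by rewrite ler_wpM2l // XM.
Qed.

(* u <= 1 + u^2 avoids a square root, as the constants are irrelevant. *)
Lemma dist_le_bregman_max a b : X a -> X b ->
  N (a - b) <= 1 + 2 * bregman_max g X / rho.
Proof.
move=> Xa Xb; have := bregman_lower dg scg Xa Xb; have := bregman_le_max Xa Xb.
move: (N _) (bregman_max _ _) (bregman _ _ _) => u P c bP ub.
have h : u ^+ 2 <= 2 * P / rho by rewrite ler_pdivlMr //; lra.
by have := sqr_ge0 (u - 1); have := sqr_ge0 u; nra.
Qed.

Variables (alpha : nat -> R) (G z : nat -> 'I_n -> 'cV[R]_d) (xs : nat -> 'cV[R]_d).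
Hypothesis alpha0 : forall t, (1 <= t)%N -> 0 < alpha t.
Hypothesis alphaS : forall t, (1 <= t)%N -> alpha t.+1 <= alpha t.
Hypothesis zE : forall t i, (1 <= t <= T)%N ->
  gradient g (z t i) = gradient g (x t i) - alpha t *: G t i.
Hypothesis xtP : forall t i, (1 <= t <= T)%N ->
  is_argmin_on X (fun y => bregman g y (z t i)) (xt t i).
Hypothesis xsX : forall t, (1 <= t)%N -> X (xs t).

Let D t := \sum_i bregman g (xs t) (x t i).

(** Convexity of the divergence in its second argument passes to the averaged points, and unit
    column sums remove the weights. Then the comparator moves from [xs t.+1] to [B t *m xs t] at the
    Lipschitz price, and the prediction, which does not increase divergences, is undone. *)
Lemma bregman_sum_step t : (1 <= t <= T)%N ->
  D t.+1 <= \sum_i bregman g (xs t) (xt t i)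
            + n%:R * (`|K| * N (xs t.+1 - B t *m xs t)).
Proof.
move=> tT; have t1 : (1 <= t)%N by lia.
have [A0 Ar Ac] := dA t1; have [Bb _ BXX] := BX tT.
apply: (@le_trans _ _ (\sum_i \sum_j A t i j * bregman g (xs t.+1) (B t *m xt t j))).
  by apply: ler_sum => i _; rewrite xS // neighbour_sum //; exact: convg.
rewrite exchange_big /= -[n in n%:R]card_ord -sumr_const mulr_suml -big_split /=.
apply: ler_sum => j _; rewrite -mulr_suml Ac !mul1r.
have Xt := xtX j tT; have Xs := xsX t1.
have := lipg (xsX (ltn0Sn t)) (BXX _ Xs) (BXX _ Xt).
move=> /(le_trans (ler_norm _)) h; have := Bb _ _ Xs Xt.
have : K * N (xs t.+1 - B t *m xs t) <= `|K| * N (xs t.+1 - B t *m xs t).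
  by rewrite ler_wpM2r ?is_norm_ge0 ?ler_norm.
lra.
Qed.

Lemma alpha_noninc s t : (1 <= s <= t)%N -> alpha t <= alpha s.
Proof.
move=> /andP[s1]; elim: t => [|t IH] st; first by lia.
have [->//|st'] := eqVneq s t.+1.
by apply: (le_trans (alphaS _)); [lia | apply: IH; lia].
Qed.

(* Abel summation: the coefficients 1 / alpha t are nondecreasing. *)
Lemma weighted_telescope (D' : nat -> R) (P : R) k : (1 <= k)%N ->
  (forall t, (1 <= t <= k)%N -> D' t <= P) ->
  \sum_(1 <= t < k.+1) (D' t - D' t.+1) / alpha t <= (P - D' k.+1) / alpha k.
Proof.
elim: k => // -[|k] IH _ DP.
  by rewrite big_nat1 ler_wpM2r ?invr_ge0 ?lerB ?DP // ltW ?alpha0.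
rewrite big_nat_recr //=; apply: (@le_trans _ _ ((P - D' k.+2) / alpha k.+1 + (D' k.+2 - D' k.+3) / alpha k.+2)).
  by rewrite lerD2r IH // => t tk; apply: DP; lia.
have -> : (P - D' k.+3) / alpha k.+2 = (P - D' k.+2) / alpha k.+2 + (D' k.+2 - D' k.+3) / alpha k.+2 by ring.
rewrite lerD2r ler_wpM2l ?subr_ge0 ?DP ?leqnn //.
by rewrite lef_pV2 ?posrE ?alpha0 // alphaS.
Qed.

(** Each mirror step is divided by its step size. The path terms are all charged at 1 / alpha T, the
    largest of these factors, while the divergences are summed by parts. *)
Lemma mirror_regret : (1 <= T)%N ->
  \sum_(1 <= t < T.+1) \sum_i inner (G t i) (x t i - xs t)
  <= n%:R * (bregman_max g X + `|K| * path_length N B xs T) / alpha T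
     + \sum_(1 <= t < T.+1) \sum_i alpha t / (2 * rho) * dual_norm N (G t i) ^+ 2.
Proof.
move=> T1; pose pl t := N (xs t.+1 - B t *m xs t).
apply: (@le_trans _ _ (\sum_(1 <= t < T.+1) ((D t - D t.+1) / alpha t
  + n%:R * (`|K| * pl t) / alpha T
  + \sum_i alpha t / (2 * rho) * dual_norm N (G t i) ^+ 2))).
  apply: ler_sum_nat => t tT; have t1 : (1 <= t)%N by lia.
  have at0 := alpha0 t1.
  apply: (@le_trans _ _ ((D t - \sum_i bregman g (xs t) (xt t i)) / alpha t
     + \sum_i alpha t / (2 * rho) * dual_norm N (G t i) ^+ 2)).
    rewrite -sumrB mulr_suml -big_split /=; apply: ler_sum => i _.
    have Xx : X (x t i) by apply: decision_in; lia.
    have := mirror_step nN rho0 convX dg scg at0 Xx (zE i tT) (xtP i tT) (xsX t1).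
    have ia0 : 0 <= (alpha t)^-1 by rewrite invr_ge0 ltW.
    move=> /(ler_wpM2l ia0); rewrite mulKf ?gt_eqF // => /le_trans; apply.
    rewrite mulrDr (mulrC _ (_ - _)) lerD2l le_eqVlt; apply/orP; left; apply/eqP.
    by field; rewrite !gt_eqF.
  rewrite lerD2r.
  have p0 : 0 <= n%:R * (`|K| * pl t) by rewrite !mulr_ge0 // is_norm_ge0.
  apply: (@le_trans _ _ ((D t - D t.+1) / alpha t + n%:R * (`|K| * pl t) / alpha t)).
    rewrite -mulrDl ler_wpM2r ?invr_ge0 ?(ltW at0) //.
    by have := bregman_sum_step tT; rewrite -/(pl t); lra.
  rewrite lerD2l ler_wpM2l // lef_pV2 ?posrE ?alpha0 //; apply: alpha_noninc; lia.
rewrite !big_split /= lerD2r mulrDr mulrDl; apply: lerD.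
  apply: (le_trans (@weighted_telescope D (n%:R * bregman_max g X) T T1 _)).
    move=> t tT; rewrite /D mulr_natl -[n in _ *+ n]card_ord -sumr_const; apply: ler_sum => i _.
    by apply: bregman_le_max; [apply: xsX; lia | apply: decision_in; lia].
  rewrite ler_wpM2r ?invr_ge0 ?(ltW (alpha0 T1)) // gerBl sumr_ge0 // => i _.
  by apply: (bregman_ge0 rho0 dg scg); [apply: xsX | apply: decision_in; lia].
by rewrite -mulr_suml -!mulr_sumr.
Qed.

(** The initial spread is bounded through [bregman_max] and not through the diameter [MX], on which
    the final constant may not depend. *)
Lemma sum_disagreement_dual i j :
  \sum_(1 <= t < T.+1) N (x t i - x t j)
  <= M * (n%:R * (1 + 2 * bregman_max g X / rho)
          + \sum_(1 <= s < T.+1) \sum_l alpha s / rho * dual_norm N (G s l)).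
Proof.
apply: (le_trans (sum_disagreement i j)).
have n0 : (0 < n)%N by apply: leq_trans (ltn_ord i).
have M0 : 0 <= M.
  rewrite /M !mulr_ge0 ?sqr_ge0 ?invr_ge0 ?powR_ge0 // subr_ge0 ltW //.
  exact: net_sigma_lt1.
rewrite ler_wpM2l //; apply: lerD.
  rewrite mulr_natl -[n in _ *+ n]card_ord -sumr_const; apply: ler_sum => l _.
  by apply: dist_le_bregman_max; apply: decision_in.
apply: ler_sum_nat => s sT; apply: ler_sum => l _.
have s1 : (1 <= s)%N by lia.
have Xx : X (x s l) by apply: decision_in; lia.
have := mirror_step_displacement nN convX dg scg (alpha0 s1) Xx (zE l sT) (xtP l sT).
by rewrite is_norm_sub // mulrAC ler_pdivlMr // mulrC.
Qed.

End Pathwise.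

(** * Expectations *)

Section Expectation.
Context {R : realType} {disp : measure_display} {Omega : measurableType disp}.
Variable P : probability Omega R.
Implicit Types (f g h Z W : Omega -> R).

(* Measurability is not needed: the integral of a nonnegative function is a
   supremum over the simple functions below it. *)
Lemma integralT_le (F U : Omega -> \bar R) : (forall w, F w <= U w)%E ->
  (\int[P]_w F w <= \int[P]_w U w)%E.
Proof.
move=> FU; rewrite /integral !patch_setT; apply: leeB; apply: ereal_sup_le => _ [s /= sF <-];
  exists s => //= w; apply: (le_trans (sF w)).
- by rewrite !funeposE ge_max !le_max FU lexx orbT.
- by rewrite !funenegE ge_max !le_max leeN2 FU lexx orbT.
Qed.

Definition integ f := P.-integrable setT (EFin \o f).

Lemma integD f g : integ f -> integ g -> integ (fun w => f w + g w).
Proof. by move=> If Ig; exact: (integrableD measurableT If Ig). Qed.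

Lemma integZ k f : integ f -> integ (fun w => k * f w).
Proof. by move=> If; exact: (integrableZl measurableT k If). Qed.

Lemma integN f : integ f -> integ (fun w => - f w).
Proof.
move=> /(integZ (-1)); congr (P.-integrable _ _); apply/funext => w /=.
by rewrite mulN1r.
Qed.

Lemma integ_sum (I : Type) (s : seq I) (F : I -> Omega -> R) :
  (forall i, integ (F i)) -> integ (fun w => \sum_(i <- s) F i w).
Proof.
move=> IF; have := integrable_sum measurableT s (P := xpredT) (fun i _ => IF i).
by congr (P.-integrable _ _); apply/funext => w /=; rewrite sumEFin.
Qed.

Lemma integ_sum_nat a b (F : nat -> Omega -> R) :
  (forall i, (a <= i < b)%N -> integ (F i)) ->
  integ (fun w => \sum_(a <= i < b) F i w).
Proof.
move=> IF; pose F' i := if (a <= i < b)%N then F i else cst 0.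
have IF' i : integ (F' i).
  rewrite /F'; case: ifP => [/IF //|_]; exact: integrable0.
have := integ_sum (index_iota a b) IF'; congr integ; apply/funext => w.
by apply: eq_big_nat => i iab; rewrite /F' iab.
Qed.

Lemma integ_cst c : integ (cst c).
Proof. exact: finite_measure_integrable_cst. Qed.

Lemma integM_bounded f h c : integ f -> measurable_fun setT h ->
  (forall w, `|h w| <= c) -> integ (fun w => f w * h w).
Proof.
move=> If mh hc; have := integrableMl measurableT If mh; apply.
exists c; split => [|x cx w _ /=]; first exact: num_real.
by apply: (le_trans (hc w)); rewrite ltW.
Qed.

Local Notation "''Ex' f" := (Rintegral P setT f) (at level 10, f at level 8).

Lemma ExD f g : integ f -> integ g -> 'Ex (fun w => f w + g w) = 'Ex f + 'Ex g.
Proof. by move=> ? ?; exact: RintegralD. Qed.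

Lemma ExZ k f : integ f -> 'Ex (fun w => k * f w) = k * 'Ex f.
Proof. by move=> ?; exact: RintegralZl. Qed.

Lemma ExB f g : integ f -> integ g -> 'Ex (fun w => f w - g w) = 'Ex f - 'Ex g.
Proof. by move=> ? ?; exact: RintegralB. Qed.

Lemma Ex_cst c : 'Ex (cst c) = c.
Proof. by rewrite Rintegral_cst //= probability_setT mulr1. Qed.

Lemma le_Ex f g : integ f -> integ g -> (forall w, f w <= g w) -> 'Ex f <= 'Ex g.
Proof. by move=> ? ? fg; apply: le_Rintegral. Qed.

Lemma Ex_sum (I : Type) (s : seq I) (F : I -> Omega -> R) :
  (forall i, integ (F i)) ->
  'Ex (fun w => \sum_(i <- s) F i w) = \sum_(i <- s) 'Ex (F i).
Proof.
move=> IF; elim: s => [|i s IH].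
  rewrite big_nil -[RHS](Ex_cst 0); apply: eq_Rintegral => w _.
  by rewrite big_nil.
rewrite big_cons -IH -ExD //; last exact: integ_sum.
by apply: eq_Rintegral => w _; rewrite big_cons.
Qed.

Lemma Ex_sum_nat a b (F : nat -> Omega -> R) :
  (forall i, (a <= i < b)%N -> integ (F i)) ->
  'Ex (fun w => \sum_(a <= i < b) F i w) = \sum_(a <= i < b) 'Ex (F i).
Proof.
move=> IF; pose F' i := if (a <= i < b)%N then F i else cst 0.
have IF' i : integ (F' i).
  rewrite /F'; case: ifP => [/IF //|_]; exact: integrable0.
rewrite [RHS](eq_big_nat _ _ (F2 := fun i => 'Ex (F' i))).
  rewrite -Ex_sum //; apply: eq_Rintegral => w _.
  by apply: eq_big_nat => i iab; rewrite /F' iab.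
by move=> i iab; rewrite /F' iab.
Qed.

(** Integrability is asked of the majorant alone: [F] will be the regret gap, of unknown
    measurability. *)
Lemma expectation_le_integ F f : integ f -> (forall w, F w <= f w) ->
  ('E_P[F] <= ('Ex f)%:E)%E.
Proof.
move=> If Ff; rewrite unlock /Rintegral fineK; last exact: integrable_fin_num.
by apply: integralT_le => w; rewrite lee_fin.
Qed.

Lemma expectation_ge_integ F f : integ f -> (forall w, - f w <= F w) ->
  ((- 'Ex f)%:E <= 'E_P[F])%E.
Proof.
move=> If Ff; have -> : - 'Ex f = 'Ex (fun w => - f w).
  by rewrite -mulN1r -ExZ //; apply: eq_Rintegral => w _; rewrite mulN1r.
rewrite unlock /Rintegral fineK; last exact: integrable_fin_num (integN If).
by apply: integralT_le => w; rewrite lee_fin.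
Qed.

(** The sum counts the positive integers up to [y]: it is the integer part of [y] as a combination
    of threshold indicators. *)
Lemma staircase_approx m (y : R) : 0 <= y < m%:R ->
  `|y - \sum_(1 <= k < m) (k%:R <= y)%R%:R| <= 1.
Proof.
elim: m => [|[|m] IH] /andP[y0 ym]; first by move: ym; rewrite ltNge y0.
  by rewrite big_geq // subr0 ger0_norm // ltW.
rewrite big_nat_recr //=; have [my|ym'] := leP m.+1%:R y; last first.
  by rewrite addr0 IH // y0.
rewrite (eq_big_nat _ _ (F2 := fun=> 1)); last first.
  by move=> k /andP[_ km]; rewrite (le_trans _ my) // ler_nat ltnW.
rewrite sumr_const_nat subn1 /= -natrD addn1 ger0_norm ?subr_ge0 // lerBlDl.
by rewrite natr1 ltW.
Qed.

(* A bounded G-measurable h is uniformly approximated by combinations of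
   indicators of sets of G. *)
Lemma condexp_mul_bounded (G : set (set Omega)) Z W h c :
  is_condexp P G Z W -> G `<=` measurable ->
  preimage_set_system setT h measurable `<=` G -> (forall w, `|h w| <= c) ->
  'Ex (fun w => Z w * h w) = 'Ex (fun w => W w * h w).
Proof.
move=> [IZ IW _ ZW] Gm hG hc.
have mh : measurable_fun setT h.
  by move=> _ B mB; apply: Gm; apply: hG; exists B.
have msub a : G [set w | a <= h w].
  apply: hG; exists `[a, +oo[%classic; first exact: measurable_itv.
  by rewrite setTI; apply/seteqP; split => w /=; rewrite in_itv /= andbT.
pose ind a w : R := (a <= h w)%R%:R.
have mind a : measurable_fun setT (ind a).
  have -> : ind a = \1_[set w | a <= h w].
    by apply/funext => w; rewrite /ind indicE mem_setE.
  by apply: measurable_realfun.measurable_indic; apply: Gm.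
have indb a w : `|ind a w| <= 1 by rewrite /ind; case: (a <= h w); rewrite /= ?mulr1n ?mulr0n ?normr1 ?normr0 ?ler01.
have Eind V a : integ V -> 'Ex (fun w => V w * ind a w) = Rintegral P [set w | a <= h w] V.
  move=> IV; rewrite [RHS]Rintegral_mkcond; apply: eq_Rintegral => w _.
  rewrite /patch /ind; have [ah|ah] := boolP (a <= h w).
    by rewrite mem_set // mulr1.
  by rewrite memNset ?mulr0 //; apply/negP.
have ZWind a : 'Ex (fun w => Z w * ind a w) = 'Ex (fun w => W w * ind a w).
  by rewrite !Eind // /Rintegral ZW.
have IV0 V : integ V -> integ (fun w => V w * h w) by move=> IV; exact: integM_bounded IV mh hc.
pose Cst := 'Ex (fun w => `|Z w|) + 'Ex (fun w => `|W w|).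
have c0 : 0 <= c by have := hc point; apply: le_trans.
(* Discretising [h] with mesh 1/q costs at most Cst / q, and q is arbitrary. *)
suff main q : (0 < q)%N ->
    `|'Ex (fun w => Z w * h w) - 'Ex (fun w => W w * h w)| * q%:R <= Cst.
  apply/eqP; rewrite -subr_eq0 -normr_le0 leNgt; apply/negP => D0.
  set D := `|_| in D0 main.
  have := main (Num.truncn (Cst / D)).+1 isT; rewrite leNgt => /negP; apply.
  by rewrite mulrC -ltr_pdivrMr // truncnS_gt.
move=> q0; have qR : 0 < q%:R :> R by rewrite ltr0n.
(* q (h + c) lies in [0, 2cq], hence below [m]; [hq] is its integer part, rescaled and shifted
   back. *)
pose m := (Num.truncn (2 * c * q%:R)).+1.
pose hq w := q%:R^-1 * (\sum_(1 <= k < m) ind (k%:R / q%:R - c) w) - c.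
have hqE V w : V w * hq w =
    q%:R^-1 * (\sum_(1 <= k < m) V w * ind (k%:R / q%:R - c) w) + (- c) * V w.
  by rewrite /hq -mulr_sumr; ring.
have happ w : `|h w - hq w| <= q%:R^-1.
  have -> : h w - hq w = q%:R^-1 * (q%:R * (h w + c) -
      \sum_(1 <= k < m) (k%:R <= q%:R * (h w + c))%R%:R).
    rewrite mulrBr mulKf ?gt_eqF // /hq opprB addrA; congr (_ - _ * _).
    apply: eq_bigr => k _; rewrite /ind lerBlDr ler_pdivrMr //.
    by rewrite [in RHS]mulrC.
  rewrite normrM ger0_norm ?invr_ge0 ?(ltW qR) // ler_piMr ?invr_ge0 ?(ltW qR) //.
  have := hc w; rewrite ler_norml => /andP[hl hu].
  apply: staircase_approx; apply/andP; split; first by rewrite mulr_ge0 ?(ltW qR) //; lra.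
  apply: le_lt_trans (truncnS_gt _); rewrite mulrC ler_pM2r //; lra.
have Iind V k : integ V -> integ (fun w => V w * ind (k%:R / q%:R - c) w).
  by move=> IV; exact: integM_bounded IV (mind _) (indb _).
have Ihq V : integ V -> integ (fun w => V w * hq w).
  move=> IV; have -> : (fun w => V w * hq w) = (fun w => q%:R^-1 *
    (\sum_(1 <= k < m) V w * ind (k%:R / q%:R - c) w) + (- c) * V w) by apply/funext.
  apply: integD; last exact: integZ.
  by apply: integZ; apply: integ_sum => k; exact: Iind.
have Ehq V : integ V -> 'Ex (fun w => V w * hq w) = q%:R^-1 *
    (\sum_(1 <= k < m) 'Ex (fun w => V w * ind (k%:R / q%:R - c) w)) + (- c) * 'Ex V.
  move=> IV; rewrite -Ex_sum; last by move=> k; exact: Iind.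
  have Is : integ (fun w => \sum_(1 <= k < m) V w * ind (k%:R / q%:R - c) w).
    by apply: integ_sum => k; exact: Iind.
  rewrite -ExZ // -ExZ // -ExD; [|exact: integZ|exact: integZ].
  by apply: eq_Rintegral => w _; exact: hqE.
(* The set where - c <= h is the whole space, which therefore belongs to [G]. *)
have EZW : 'Ex Z = 'Ex W.
  rewrite /Rintegral ZW //; have := msub (- c); congr G.
  apply/seteqP; split => // w _ /=; have := hc w.
  by rewrite ler_norml => /andP[].
have EhqZW : 'Ex (fun w => Z w * hq w) = 'Ex (fun w => W w * hq w).
  rewrite !Ehq // EZW; congr (_ * _ + _); apply: eq_bigr => k _; exact: ZWind.
have Iabs V : integ V -> integ (fun w => `|V w|) by move=> IV; exact: (integrable_norm IV).
have err V : integ V ->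
    `|'Ex (fun w => V w * h w) - 'Ex (fun w => V w * hq w)| <= q%:R^-1 * 'Ex (fun w => `|V w|).
  move=> IV; rewrite -ExB ?IV0 ?Ihq //.
  have ID : integ (fun w => V w * h w - V w * hq w).
    by apply: (integD (IV0 _ IV)); apply: integN; exact: Ihq.
  apply: (le_trans (le_normr_Rintegral measurableT ID)).
  rewrite -ExZ ?Iabs //; apply: le_Ex; [exact: Iabs|by apply: integZ; exact: Iabs|].
  by move=> w; rewrite -mulrBr normrM mulrC ler_wpM2r.
rewrite -ler_pdivlMr // mulrDl !(mulrC _ q%:R^-1).
have -> : 'Ex (fun w => Z w * h w) - 'Ex (fun w => W w * h w)
  = ('Ex (fun w => Z w * h w) - 'Ex (fun w => Z w * hq w))
    - ('Ex (fun w => W w * h w) - 'Ex (fun w => W w * hq w)) by rewrite EhqZW; ring.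
by apply: (le_trans (ler_normB _ _)); apply: lerD; apply: err.
Qed.

Lemma condexp_bound (G : set (set Omega)) Z S c : G setT -> 0 <= c ->
  is_condexp P G Z S -> {ae P, forall w, S w <= c} -> 'Ex Z <= c.
Proof.
move=> GT c0 [IZ IS _ ZS] Sc.
have mS : measurable_fun setT S by apply/measurable_realfun.measurable_EFinP; exact: measurable_int IS.
have EZ : (('Ex Z)%:E = \int[P]_w (S w)%:E)%E.
  by rewrite /Rintegral fineK -?ZS //; exact: integrable_fin_num IZ.
rewrite -lee_fin EZ.
(* [S] may be negative and is bounded only almost everywhere. Its positive part keeps the bound, as
   [c] is nonnegative, and allows comparing nonnegative integrals. *)
apply: (@le_trans _ _ (\int[P]_w (Num.max (S w) 0)%:E)%E).
  by apply: integralT_le => w; rewrite lee_fin le_max lexx.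
apply: (@le_trans _ _ (\int[P]_w c%:E)%E).
  apply: ae_ge0_le_integral => //.
  - by move=> w _; rewrite lee_fin le_max lexx orbT.
  - by apply/measurable_realfun.measurable_EFinP; exact: measurable_realfun.measurable_maxr.
  - by move: Sc; apply: filterS => w Swc _; rewrite lee_fin ge_max Swc.
by rewrite integral_cst //= probability_setT mule1.
Qed.

End Expectation.

(** * One player in expectation: [H] is the conditional mean of the oracle answer [G] *)

Section OneSide.
Context {R : realType} {n d : nat}.
Context {disp : measure_display} {Omega : measurableType disp}.
Variable P : probability Omega R.
Variables (zeta : R) (Q : nat) (E : nat -> rel 'I_n) (A : nat -> 'M[R]_n).
Hypotheses (Q0 : (0 < Q)%N) (zeta01 : 0 < zeta < 1).
Hypothesis jsc : jointly_strongly_connected Q E.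
Hypothesis AE : forall t, (1 <= t)%N -> weight_matrix zeta E t (A t).
Variables (N : 'cV[R]_d -> R) (X : set 'cV[R]_d) (g : 'cV[R]_d -> R).
Hypotheses (nN : is_norm N) (convX : convex_set X).
Variables (B : nat -> 'M[R]_d) (T : nat).
Hypothesis T1 : (1 <= T)%N.
Hypothesis BX : forall t, (1 <= t <= T)%N -> admissible_prediction N X g (B t).
Variables (rho K MX L : R).
Hypothesis rho0 : 0 < rho.
Hypothesis XM : forall a b, X a -> X b -> N (a - b) <= MX.
Hypothesis dg : forall a, differentiable (g : 'cV[R]_d -> R^o) a.
Hypothesis scg : strongly_convex_on N X rho g.
Hypothesis lipg : bregman_lipschitz N X g K.
Hypothesis convg : bregman_separately_convex n g.
Variables (alpha : nat -> R) (xs : nat -> 'cV[R]_d).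
Hypothesis alpha0 : forall t, (1 <= t)%N -> 0 < alpha t.
Hypothesis alphaS : forall t, (1 <= t)%N -> alpha t.+1 <= alpha t.
Hypothesis xsX : forall t, (1 <= t)%N -> X (xs t).
Variables (x xt z G H : nat -> 'I_n -> Omega -> 'cV[R]_d).
Hypothesis x1X : forall i w, X (x 1%N i w).
Hypothesis xtP : forall t i w, (1 <= t <= T)%N ->
  is_argmin_on X (fun y => bregman g y (z t i w)) (xt t i w).
Hypothesis xS : forall t i w, (1 <= t <= T)%N ->
  x t.+1 i w = \sum_(j | in_neighbour E t i j) A t i j *: (B t *m xt t j w).
Hypothesis zE : forall t i w, (1 <= t <= T)%N ->
  gradient g (z t i w) = gradient g (x t i w) - alpha t *: G t i w.
Variable past : nat -> set (set Omega).
Hypothesis pastT : forall t, past t setT.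
Hypothesis pastm : forall t, (1 <= t <= T)%N -> past t `<=` measurable.
Hypothesis xm : forall t i, (1 <= t <= T)%N -> measurable_vec (past t) (x t i).
Hypothesis GH : forall t i k, (1 <= t <= T)%N ->
  is_condexp P (past t) (fun w => G t i w k 0) (fun w => H t i w k 0).
Hypothesis Gsq : forall t i, (1 <= t <= T)%N -> exists2 S : Omega -> R,
  is_condexp P (past t) (fun w => dual_norm N (G t i w) ^+ 2) S
  & {ae P, forall w, S w <= L ^+ 2}.

Local Notation "''Ex' f" := (Rintegral P setT f) (at level 10, f at level 8).

Let xtX t i w : (1 <= t <= T)%N -> X (xt t i w).
Proof. by move=> tT; case: (@xtP t i w tT). Qed.

Let xX t i w : (1 <= t <= T)%N -> X (x t i w).
Proof.
move=> tT; apply: (decision_in AE convX BX (x := fun t i => x t i w)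
  (xt := fun t i => xt t i w)) => //; first by move=> *; apply: xtX.
  by move=> *; apply: xS.
lia.
Qed.

Lemma integ_dual_sq t i : (1 <= t <= T)%N ->
  integ P (fun w => dual_norm N (G t i w) ^+ 2).
Proof. by move=> tT; have [S [IG _ _ _] _] := @Gsq t i tT. Qed.

Lemma Ex_dual_sq t i : (1 <= t <= T)%N ->
  'Ex (fun w => dual_norm N (G t i w) ^+ 2) <= L ^+ 2.
Proof.
move=> tT; have [S SG SL] := @Gsq t i tT.
by apply: (condexp_bound (pastT t) _ SG SL); exact: sqr_ge0.
Qed.

Let h t i k w := (x t i w - xs t) k 0.

Let h_past t i k : (1 <= t <= T)%N -> preimage_set_system setT (h t i k) measurable `<=` past t.
Proof.
move=> tT _ [C mC <-].
have mC' : measurable ((fun y : R => y - xs t k 0) @^-1` C).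
  rewrite -[X in measurable X]setTI.
  exact: (measurable_realfun.measurable_funB (@measurable_id _ _ setT) (measurable_cst _)).
have xmi : coord_events (x t i) `<=` past t := @xm t i tT.
apply: xmi; exists k => //; exists ((fun y : R => y - xs t k 0) @^-1` C) => //.
by apply/seteqP; split => w; rewrite /h /= !mxE.
Qed.

Let h_meas t i k : (1 <= t <= T)%N -> measurable_fun setT (h t i k).
Proof.
move=> tT _ C mC; have pm : past t `<=` measurable := pastm tT.
apply: pm; have hp : preimage_set_system setT (h t i k) measurable `<=` past t := @h_past t i k tT.
by apply: hp; exists C.
Qed.

Let h_bounded : exists c, forall t i k w, (1 <= t <= T)%N -> `|h t i k w| <= c.
Proof.
have [c c0 cN] := coord_le_is_norm nN.
exists (c * MX) => t i k w tT; apply: (le_trans (cN _ _)); rewrite ler_wpM2l //.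
by apply: XM; [exact: xX | apply: xsX; lia].
Qed.

Let innerE (V : nat -> 'I_n -> Omega -> 'cV[R]_d) t i w :
  inner (V t i w) (x t i w - xs t) = \sum_k V t i w k 0 * h t i k w.
Proof. by []. Qed.

Let integ_inner (V : nat -> 'I_n -> Omega -> 'cV[R]_d) t i : (1 <= t <= T)%N ->
  (forall k, integ P (fun w => V t i w k 0)) ->
  integ P (fun w => inner (V t i w) (x t i w - xs t)).
Proof.
move=> tT IV; apply: integ_sum => k; have [c hc] := h_bounded.
by apply: (integM_bounded (IV k) (@h_meas t i k tT)) => w; exact: hc.
Qed.

Let IG t i k : (1 <= t <= T)%N -> integ P (fun w => G t i w k 0).
Proof. by move=> tT; case: (@GH t i k tT). Qed.

Let IH t i k : (1 <= t <= T)%N -> integ P (fun w => H t i w k 0).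
Proof. by move=> tT; case: (@GH t i k tT). Qed.

Lemma integ_gradient_gap : integ P (fun w =>
  \sum_(1 <= t < T.+1) \sum_i inner (H t i w) (x t i w - xs t)).
Proof.
apply: integ_sum_nat => t tT; apply: integ_sum => i.
by apply: integ_inner => // k; exact: IH.
Qed.

Let Ex_inner t i : (1 <= t <= T)%N ->
  'Ex (fun w => inner (H t i w) (x t i w - xs t))
  = 'Ex (fun w => inner (G t i w) (x t i w - xs t)).
Proof.
move=> tT; have [c hc] := h_bounded.
rewrite !Ex_sum; last 2 first.
- by move=> k; apply: (integM_bounded (@IG t i k tT) (@h_meas t i k tT)) => w; exact: hc.
- by move=> k; apply: (integM_bounded (@IH t i k tT) (@h_meas t i k tT)) => w; exact: hc.
apply: eq_bigr => k _; apply/esym.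
apply: (condexp_mul_bounded (@GH t i k tT) (pastm tT) (@h_past t i k tT)) => w; exact: hc.
Qed.

Lemma regret_expectation :
  'Ex (fun w => \sum_(1 <= t < T.+1) \sum_i inner (H t i w) (x t i w - xs t))
  <= n%:R * (bregman_max g X + `|K| * path_length N B xs T) / alpha T
     + n%:R * L ^+ 2 / (2 * rho) * \sum_(1 <= t < T.+1) alpha t.
Proof.
have Iin t : (1 <= t < T.+1)%N -> integ P (fun w => \sum_i inner (G t i w) (x t i w - xs t)).
  by move=> tT; apply: integ_sum => i; apply: integ_inner => // k; exact: IG.
have -> : 'Ex (fun w => \sum_(1 <= t < T.+1) \sum_i inner (H t i w) (x t i w - xs t))
   = 'Ex (fun w => \sum_(1 <= t < T.+1) \sum_i inner (G t i w) (x t i w - xs t)).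
  rewrite !Ex_sum_nat //; last first.
    by move=> t tT; apply: integ_sum => i; apply: integ_inner => // k; exact: IH.
  apply: eq_big_nat => t tT.
  rewrite !Ex_sum; first by apply: eq_bigr => i _; exact: Ex_inner.
  - by move=> i; apply: integ_inner => // k; exact: IG.
  - by move=> i; apply: integ_inner => // k; exact: IH.
have Isq t : (1 <= t < T.+1)%N ->
    integ P (fun w => \sum_i alpha t / (2 * rho) * dual_norm N (G t i w) ^+ 2).
  by move=> tT; apply: integ_sum => i; apply: integZ; exact: integ_dual_sq.
set c1 := n%:R * _ / _.
apply: (@le_trans _ _ ('Ex (fun w => c1 + \sum_(1 <= t < T.+1)
    \sum_i alpha t / (2 * rho) * dual_norm N (G t i w) ^+ 2))).
  apply: le_Ex.
  - exact: integ_sum_nat.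
  - by apply: integD; [exact: integ_cst | exact: integ_sum_nat].
  move=> w; apply: (mirror_regret Q0 zeta01 AE nN convX BX (x := fun t i => x t i w)
    (xt := fun t i => xt t i w) _ _ _ rho0 XM dg scg lipg convg alpha0 alphaS
    (G := fun t i => G t i w) (z := fun t i => z t i w)) => //.
  - by move=> *; exact: xtX.
  - by move=> *; exact: xS.
  - by move=> *; exact: zE.
  - by move=> *; exact: xtP.
rewrite ExD; [|exact: integ_cst|exact: integ_sum_nat].
rewrite Ex_cst lerD2l Ex_sum_nat // mulr_sumr.
apply: ler_sum_nat => t tT; rewrite Ex_sum; last first.
  by move=> i; apply: integZ; exact: integ_dual_sq.
have -> : n%:R * L ^+ 2 / (2 * rho) * alpha t = \sum_(i < n) alpha t / (2 * rho) * L ^+ 2.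
  rewrite sumr_const card_ord -[RHS]mulr_natl; ring.
apply: ler_sum => i _; rewrite ExZ; last exact: integ_dual_sq.
have at0 : 0 < alpha t by apply: alpha0; lia.
by rewrite ler_wpM2l ?Ex_dual_sq // divr_ge0 ?mulr_ge0 // ltW.
Qed.

(** One integrable majorant serves all pairs of agents: the pathwise bound with each dual norm D
    replaced by 1 + D^2, whose expectation the second moments control. *)
Lemma disagreement_expectation : exists U : Omega -> R,
  [/\ integ P U,
      forall w i j, \sum_(1 <= t < T.+1) N (x t i w - x t j w) <= U w
    & 'Ex U <= 4 * n%:R ^+ 3 * (net_Gamma n Q zeta / (1 - net_sigma n Q zeta))
       * (1 + 2 * bregman_max g X / rho
          + (1 + L ^+ 2) / rho * \sum_(1 <= s < T.+1) alpha s)].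
Proof.
set M := net_Gamma n Q zeta / _.
pose c1 := n%:R * (1 + 2 * bregman_max g X / rho).
pose F s l w := alpha s / rho * (1 + dual_norm N (G s l w) ^+ 2).
have IF s l : (1 <= s < T.+1)%N -> integ P (F s l).
  move=> sT; apply: integZ; apply: integD; first exact: integ_cst.
  exact: integ_dual_sq.
have IFs s : (1 <= s < T.+1)%N -> integ P (fun w => \sum_l F s l w).
  by move=> sT; apply: integ_sum => l; exact: IF.
have IFF : integ P (fun w => \sum_(1 <= s < T.+1) \sum_l F s l w) by exact: integ_sum_nat.
have M0 : (0 < n)%N -> 0 <= 4 * n%:R ^+ 2 * M.
  move=> n0.
  rewrite /M !mulr_ge0 ?sqr_ge0 ?invr_ge0 ?powR_ge0 // subr_ge0 ltW //.
  exact: net_sigma_lt1.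
exists (fun w => 4 * n%:R ^+ 2 * M * (c1 + \sum_(1 <= s < T.+1) \sum_l F s l w)); split.
- by apply: integZ; apply: integD => //; exact: integ_cst.
- move=> w i j.
  have n0 : (0 < n)%N by apply: leq_trans (ltn_ord i).
  have := sum_disagreement_dual Q0 zeta01 jsc AE nN convX BX (x := fun t i => x t i w)
    (xt := fun t i => xt t i w) (fun i => x1X i w) (fun t i => @xtX t i w)
    (fun t i => @xS t i w) rho0 XM dg scg lipg alpha0
    (G := fun t i => G t i w) (fun t i => @zE t i w) (fun t i => @xtP t i w) i j.
  move=> /le_trans; apply; rewrite ler_wpM2l ?M0 // lerD2l.
  apply: ler_sum_nat => s sT; apply: ler_sum => l _; rewrite /F ler_wpM2l //.
    by rewrite divr_ge0 // ltW // alpha0 //; lia.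
  by have := sqr_ge0 (dual_norm N (G s l w) - 1); have := sqr_ge0 (dual_norm N (G s l w)); nra.
rewrite ExZ; last by apply: integD => //; exact: integ_cst.
have [n0|n0] := posnP n.
  have -> : n%:R = 0 :> R by rewrite n0.
  by rewrite !expr0n /= !(mulr0, mul0r).
have -> : 4 * n%:R ^+ 3 * M * (1 + 2 * bregman_max g X / rho
    + (1 + L ^+ 2) / rho * \sum_(1 <= s < T.+1) alpha s)
  = 4 * n%:R ^+ 2 * M * (c1 + \sum_(1 <= s < T.+1) n%:R * (alpha s / rho * (1 + L ^+ 2))).
  by rewrite /c1 -mulr_sumr -mulr_suml -mulr_suml; ring.
rewrite ler_wpM2l ?M0 // ExD //; last exact: integ_cst.
rewrite Ex_cst lerD2l Ex_sum_nat //; apply: ler_sum_nat => s sT.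
rewrite Ex_sum; last by move=> l; exact: IF.
rewrite mulr_natl -[n in _ *+ n]card_ord -sumr_const; apply: ler_sum => l _.
have as0 : 0 < alpha s by apply: alpha0; lia.
rewrite /F ExZ; last by apply: integD; [exact: integ_cst | exact: integ_dual_sq].
rewrite ExD; [|exact: integ_cst|exact: integ_dual_sq].
rewrite Ex_cst ler_wpM2l ?lerD2l ?Ex_dual_sq //.
by rewrite divr_ge0 // ltW.
Qed.

Lemma one_side_bounds : exists U : Omega -> R,
  let S w := \sum_(1 <= t < T.+1) \sum_i inner (H t i w) (x t i w - xs t) in
  [/\ integ P S,
      'Ex S <= n%:R * (bregman_max g X + `|K| * path_length N B xs T) / alpha T
               + n%:R * L ^+ 2 / (2 * rho) * \sum_(1 <= t < T.+1) alpha t,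
      integ P U,
      forall w i j, \sum_(1 <= t < T.+1) N (x t i w - x t j w) <= U w
    & 'Ex U <= 4 * n%:R ^+ 3 * (net_Gamma n Q zeta / (1 - net_sigma n Q zeta))
       * (1 + 2 * bregman_max g X / rho
          + (1 + L ^+ 2) / rho * \sum_(1 <= s < T.+1) alpha s)].
Proof.
have [U [IU US EU]] := disagreement_expectation; exists U; split => //.
  exact: integ_gradient_gap.
exact: regret_expectation.
Qed.

End OneSide.

(** * Polynomial step sizes *)

Section StepSize.
Context {R : realType}.
Variables (eps gamma : R).
Hypotheses (eps0 : 0 < eps) (gamma01 : 0 < gamma < 1).

Lemma step_size_gt0 t : (1 <= t)%N -> 0 < step_size eps gamma t.
Proof.
by move=> t1; rewrite /step_size mulr_gt0 ?invr_gt0 // powR_gt0 // ltr0n.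
Qed.

Lemma step_size_noninc t : (1 <= t)%N ->
  step_size eps gamma t.+1 <= step_size eps gamma t.
Proof.
move=> t1; have /andP[g0 _] := gamma01.
rewrite /step_size ler_wpM2l ?invr_ge0 ?(ltW eps0) // !powRN.
rewrite lef_pV2 ?posrE ?powR_gt0 ?ltr0n //.
by rewrite ge0_ler_powR ?(ltW g0) ?nnegrE ?ler_nat.
Qed.

Lemma step_size_inv t : (step_size eps gamma t)^-1 = eps * t%:R `^ gamma.
Proof. by rewrite /step_size invfM invrK powRN invrK. Qed.

(* Young's inequality: the exponent p = 1 - gamma satisfies (1 - u)^p <= 1 - p u. *)
Lemma powR_bernoulli (p u : R) : 0 < p < 1 -> 0 <= u <= 1 ->
  (1 - u) `^ p <= 1 - p * u.
Proof.
move=> /andP[p0 p1] /andP[u0 u1].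
have q0 : 0 < (1 - p)^-1 by rewrite invr_gt0 subr_gt0.
have := @conjugate_powR R ((1 - u) `^ p) 1 p^-1 (1 - p)^-1 (powR_ge0 _ _) ler01.
rewrite invr_gt0 !invrK mulr1 powR1 -powRrM mulfV ?gt_eqF // powRr1 ?subr_ge0 //.
move=> /(_ p0 q0); have -> : p + (1 - p) = 1 by ring.
move=> /(_ erefl); lra.
Qed.

(** Induction on [T]: with s = T + 1 one has T = s (1 - 1/s), and [powR_bernoulli] shows that s^(1 -
    gamma) exceeds T^(1 - gamma) by at least (1 - gamma) s^(-gamma). *)
Lemma sum_step_size T :
  \sum_(1 <= t < T.+1) step_size eps gamma t
  <= eps^-1 / (1 - gamma) * T%:R `^ (1 - gamma).
Proof.
have /andP[g0 g1] := gamma01; have p0 : 0 < 1 - gamma by rewrite subr_gt0.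
rewrite -mulr_sumr -mulrA ler_wpM2l ?invr_ge0 ?(ltW eps0) //.
elim: T => [|T IH]; first by rewrite big_geq // mulr_ge0 ?powR_ge0 // invr_ge0 ltW.
rewrite big_nat_recr //=; apply: (le_trans (lerD IH (lexx _))).
set s : R := T.+1%:R; have s0 : 0 < s by rewrite ltr0n.
have TE : T%:R = s * (1 - s^-1) by rewrite mulrBr mulfV ?gt_eqF // mulr1 /s -natr1 addrK.
have s1 : s^-1 <= 1 by rewrite invf_le1 // ler1n.
have is0 : 0 <= s^-1 by rewrite invr_ge0 ltW.
rewrite TE powRM ?subr_ge0 ?(ltW s0) //.
have sg : s `^ (- gamma) = s `^ (1 - gamma) * s^-1.
  by rewrite -powR_inv1 ?(ltW s0) // -powRD; [congr (_ `^ _); ring | apply/implyP => _; rewrite gt_eqF].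
have := @powR_bernoulli (1 - gamma) s^-1; rewrite p0 s1 is0.
have -> : 1 - gamma < 1 by rewrite gtrBl.
move=> /(_ isT isT) bern.
have P0 : 0 <= s `^ (1 - gamma) by exact: powR_ge0.
rewrite sg -[X in _ + X](mulKf (x := 1 - gamma)) ?gt_eqF // -mulrDr.
rewrite ler_wpM2l ?invr_ge0 ?(ltW p0) //.
have := ler_wpM2l P0 bern.
move: (s `^ (1 - gamma)) ((1 - s^-1) `^ (1 - gamma)) (s^-1) => a b c; lra.
Qed.

End StepSize.

(** * Lipschitz bounds from oracle moments, and measurability of decisions *)

Section OracleBounds.
Context {R : realType} {d : nat} {disp : measure_display} {Omega : measurableType disp}.
Variable P : probability Omega R.
Variables (N : 'cV[R]_d -> R).
Hypothesis nN : is_norm N.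

Lemma dual_normN u : dual_norm N (- u) = dual_norm N u.
Proof.
rewrite /dual_norm; congr sup; apply/seteqP; split => _ [v /= v1 <-];
  by exists (- v); rewrite /= ?(is_normN nN) // innerNl innerNr ?opprK.
Qed.

Lemma is_condexpN (G : set (set Omega)) (Z W : Omega -> R) : G `<=` measurable ->
  is_condexp P G Z W -> is_condexp P G (fun w => - Z w) (fun w => - W w).
Proof.
move=> Gm [IZ IW mW ZW]; split; [exact: integN|exact: integN| |].
  move=> _ [C mC <-]; apply: mW; exists ((fun y : R => - y) @^-1` C) => //.
  by rewrite -[X in measurable X]setTI; exact: (measurable_realfun.oppr_measurable measurableT).
move=> S GS; have mS := Gm _ GS.
have IS V : P.-integrable setT (EFin \o V) -> P.-integrable S (EFin \o V).
  by move=> IV; exact: (integrableS measurableT mS _ IV).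
have intN V : P.-integrable setT (EFin \o V) ->
    (\int[P]_(w in S) (- V w)%:E = - \int[P]_(w in S) (V w)%:E)%E.
  move=> IV; under eq_integral do rewrite EFinN.
  rewrite integralN //; exact: integrable_add_def (IS _ IV).
by rewrite !intN // ZW.
Qed.

(** The gradient [v] at a fixed point is the mean of the answer [Z], so <v, a> is the mean of <Z, a>
    <= D N a with D <= 1 + D^2. With convexity this makes the payoffs Lipschitz. *)
Lemma gradient_dual_bound (G : set (set Omega)) (Z : Omega -> 'cV[R]_d) (v a : 'cV[R]_d) L :
  G setT -> (forall k, is_condexp P G (fun w => Z w k 0) (cst (v k 0))) ->
  (exists2 S : Omega -> R, is_condexp P G (fun w => dual_norm N (Z w) ^+ 2) S
     & {ae P, forall w, S w <= L ^+ 2}) ->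
  inner v a <= (1 + L ^+ 2) * N a.
Proof.
move=> GT Zv [S SG SL].
have IZ k : integ P (fun w => Z w k 0) by case: (Zv k).
have EZ k : Rintegral P setT (fun w => Z w k 0) = v k 0.
  have [_ _ _ ZW] := Zv k; rewrite -[RHS](Ex_cst P).
  by rewrite /Rintegral ZW.
have Isq : integ P (fun w => dual_norm N (Z w) ^+ 2) by case: SG.
have -> : inner v a = Rintegral P setT (fun w => inner (Z w) a).
  have -> : (fun w => inner (Z w) a) = (fun w => \sum_k a k 0 * Z w k 0).
    by apply/funext => w; apply: eq_bigr => k _; rewrite mulrC.
  rewrite Ex_sum; last by move=> k; exact: integZ.
  by apply: eq_bigr => k _; rewrite ExZ // EZ mulrC.
apply: (@le_trans _ _ (Rintegral P setT (fun w => N a * (1 + dual_norm N (Z w) ^+ 2)))).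
  apply: le_Ex.
  - have -> : (fun w => inner (Z w) a) = (fun w => \sum_k a k 0 * Z w k 0).
      by apply/funext => w; apply: eq_bigr => k _; rewrite mulrC.
    by apply: integ_sum => k; exact: integZ.
  - by apply: integZ; apply: integD => //; exact: integ_cst.
  move=> w; apply: (le_trans (inner_le_dual nN _ _)); rewrite mulrC ler_wpM2l ?is_norm_ge0 //.
  by have := sqr_ge0 (dual_norm N (Z w) - 1); have := sqr_ge0 (dual_norm N (Z w)); nra.
rewrite ExZ; last by apply: integD => //; exact: integ_cst.
rewrite ExD //; last exact: integ_cst.
rewrite Ex_cst mulrC ler_wpM2r ?is_norm_ge0 // lerD2l.
by apply: (condexp_bound GT _ SG SL); exact: sqr_ge0.
Qed.

(** Turns inclusion of sigma-fields into measurability of functions on [g_sigma_algebraType], where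
    closure under sums and products is at hand. *)
Lemma sigma_measurable_vec (U : set (set Omega)) (u : Omega -> 'cV[R]_d) :
  (forall k, measurable_fun setT ((fun w => u w k 0) : g_sigma_algebraType U -> R)) ->
  measurable_vec <<s U>> u.
Proof. by move=> mu _ [k _] [C mC <-]; exact: (mu k measurableT C mC). Qed.

Lemma measurable_vec_sigma (U : set (set Omega)) (u : Omega -> 'cV[R]_d) k :
  measurable_vec <<s U>> u ->
  measurable_fun setT ((fun w => u w k 0) : g_sigma_algebraType U -> R).
Proof. by move=> uU _ C mC; apply: uU; exists k => //; exists C. Qed.

Lemma measurable_vec_cst (U : set (set Omega)) (c : 'cV[R]_d) :
  measurable_vec <<s U>> (cst c : Omega -> 'cV[R]_d).
Proof. by apply: sigma_measurable_vec => k; exact: measurable_cst. Qed.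

Lemma measurable_vec_mix (U : set (set Omega)) n (p : 'I_n -> R) (B : 'M[R]_d)
    (u : 'I_n -> Omega -> 'cV[R]_d) (Q : pred 'I_n) :
  (forall j, measurable_vec <<s U>> (u j)) ->
  measurable_vec <<s U>> (fun w => \sum_(j | Q j) p j *: (B *m u j w)).
Proof.
move=> mu; apply: sigma_measurable_vec => k.
have -> : (fun w => (\sum_(j | Q j) p j *: (B *m u j w)) k 0) =
  (fun w => \sum_j \sum_l (if Q j then p j * B k l else 0) * u j w l 0).
  apply/funext => w; rewrite summxE big_mkcond; apply: eq_bigr => j _.
  case: ifP => _; last by rewrite big1 // => l _; rewrite mul0r.
  by rewrite !mxE mulr_sumr; apply: eq_bigr => l _; rewrite mulrA.
apply: measurable_sum => j; apply: measurable_sum => l.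
apply: measurable_realfun.measurable_funM; first exact: measurable_cst.
exact: measurable_vec_sigma.
Qed.

End OracleBounds.

(** * The saddle gap in one round *)

Section SaddleGap.
Context {R : realType} {n d m : nat}.
Variables (NX : 'cV[R]_d -> R) (NY : 'cV[R]_m -> R).
Variables (X : set 'cV[R]_d) (Y : set 'cV[R]_m).
Variables (F : 'I_n -> 'cV[R]_d -> 'cV[R]_m -> R) (LX LY : R).
Variable DF : 'I_n -> 'cV[R]_d -> 'cV[R]_m -> 'cV[R]_d.
Hypothesis Fgrad : forall i a b y, X a -> X b -> Y y ->
  F i a y - F i b y <= inner (DF i a y) (a - b).
Hypothesis FlipX : forall i a b y, X a -> X b -> Y y -> F i a y - F i b y <= LX * NX (a - b).
Hypothesis FlipY : forall i a y y', X a -> Y y -> Y y' -> F i a y - F i a y' <= LY * NY (y - y').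

(** The saddle property replaces [ys] by [y j] at [xs]. For each agent i the path (x_j, y_j), (x_i,
    y_j), (x_i, y_i), (xs, y_i), (xs, y_j) is followed: its third leg is convexity, and y moves
    twice, whence two [LY] terms. *)
Lemma saddle_gap xs ys (x : 'I_n -> 'cV[R]_d) (y : 'I_n -> 'cV[R]_m) j :
  saddle_point X Y (fun a b => \sum_i F i a b) xs ys ->
  (forall i, X (x i)) -> (forall i, Y (y i)) ->
  \sum_i F i (x j) (y j) - \sum_i F i xs ys
  <= \sum_i inner (DF i (x i) (y i)) (x i - xs)
     + \sum_i (LX * NX (x j - x i) + (LY * NY (y j - y i) + LY * NY (y i - y j))).
Proof.
move=> [Xxs Yys sy _] Xx Yy.
apply: (@le_trans _ _ (\sum_i F i (x j) (y j) - \sum_i F i xs (y j))).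
  by rewrite lerD2l lerN2 sy.
rewrite -sumrB -big_split; apply: ler_sum => i _ /=.
have := FlipX i (Xx j) (Xx i) (Yy j); have := FlipY i (Xx i) (Yy j) (Yy i).
have := FlipY i Xxs (Yy i) (Yy j); have := Fgrad i (Xx i) Xxs (Yy i); lra.
Qed.

End SaddleGap.

(** * Rates in [T] with explicit constants *)

Section Rates.
Context {R : realType}.
Variables (n T : nat) (Psi K L rho eps gamma Mx : R).
Hypotheses (rho0 : 0 < rho) (eps0 : 0 < eps) (gamma01 : 0 < gamma < 1).
Hypothesis T1 : (1 <= T)%N.

Let c : R := eps^-1 / (1 - gamma).

(** Absolute values, because [Psi] and [K] are arbitrary reals where the constant is chosen; [c] is
    the factor from [sum_step_size]. *)
Definition regret_constant : R :=
  n%:R * (`|Psi| + `|K|) * eps + n%:R * L ^+ 2 / (2 * rho) * c.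

Definition disagreement_constant : R :=
  4 * n%:R ^+ 3 * (1 + 2 * `|Psi| / rho + (1 + L ^+ 2) / rho * c).

Let c0 : 0 <= c.
Proof. by rewrite /c divr_ge0 ?invr_ge0 ?(ltW eps0) // subr_ge0 ltW //; case/andP: gamma01. Qed.

Lemma regret_constant_ge0 : 0 <= regret_constant.
Proof.
apply: addr_ge0; first by rewrite !mulr_ge0 ?addr_ge0 ?normr_ge0 ?ler0n ?(ltW eps0).
apply: mulr_ge0; last exact: c0.
by rewrite divr_ge0 // mulr_ge0 ?sqr_ge0 ?ler0n ?(ltW rho0).
Qed.

Lemma disagreement_constant_ge0 : 0 <= disagreement_constant.
Proof.
apply: mulr_ge0; first by rewrite mulr_ge0 ?exprn_ge0 ?ler0n.
apply: addr_ge0; first by rewrite addr_ge0 // divr_ge0 ?mulr_ge0 ?normr_ge0 ?(ltW rho0).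
by apply: mulr_ge0; [rewrite divr_ge0 ?addr_ge0 ?sqr_ge0 ?(ltW rho0) | exact: c0].
Qed.

Let Tp1 : 1 <= T%:R `^ (1 - gamma).
Proof.
rewrite -[leLHS](powRr0 T%:R); apply: ler_powR; first by rewrite ler1n.
by rewrite subr_ge0 ltW //; case/andP: gamma01.
Qed.

Lemma regret_rate Vp V : 0 <= Vp <= V -> T%:R `^ (1 - gamma) <= Mx ->
  T%:R `^ gamma * (1 + V) <= Mx ->
  n%:R * (Psi + `|K| * Vp) / step_size eps gamma T
    + n%:R * L ^+ 2 / (2 * rho) * \sum_(1 <= t < T.+1) step_size eps gamma t
  <= regret_constant * Mx.
Proof.
move=> /andP[Vp0 VpV] TM TVM; rewrite step_size_inv /regret_constant [leRHS]mulrDl.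
apply: lerD.
  apply: (@le_trans _ _ (n%:R * (`|Psi| + `|K|) * eps * (T%:R `^ gamma * (1 + V)))).
    have -> : n%:R * (`|Psi| + `|K|) * eps * (T%:R `^ gamma * (1 + V)) =
      n%:R * ((`|Psi| + `|K|) * (1 + V)) * (eps * T%:R `^ gamma) by ring.
    rewrite ler_wpM2r ?(mulr_ge0 (ltW eps0)) ?powR_ge0 // ler_wpM2l //.
    have := ler_norm Psi; have := normr_ge0 Psi; have := normr_ge0 K; nra.
  by rewrite ler_wpM2l // !mulr_ge0 ?addr_ge0 // ltW.
rewrite -[leRHS]mulrA; apply: ler_wpM2l.
  by rewrite divr_ge0 // mulr_ge0 ?sqr_ge0 ?ler0n ?(ltW rho0).
apply: (le_trans (sum_step_size eps0 gamma01 T)).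
by rewrite ler_wpM2l.
Qed.

Lemma disagreement_rate r : 0 <= r -> (1 + r) * T%:R `^ (1 - gamma) <= Mx ->
  4 * n%:R ^+ 3 * r * (1 + 2 * Psi / rho
    + (1 + L ^+ 2) / rho * \sum_(1 <= t < T.+1) step_size eps gamma t)
  <= disagreement_constant * Mx.
Proof.
move=> r0; have := sum_step_size eps0 gamma01 T; rewrite -/c /disagreement_constant.
move: Tp1; move: (T%:R `^ _) (\sum_(_ <= _ < _) _) => p s p1 sc rM.
pose a := `|Psi| / rho; pose b := (1 + L ^+ 2) / rho.
have a0 : 0 <= a by rewrite divr_ge0 // ltW.
have b0 : 0 <= b by rewrite divr_ge0 ?addr_ge0 ?sqr_ge0 // ltW.
have Pa : Psi / rho <= a by rewrite ler_wpM2r ?invr_ge0 ?(ltW rho0) // ler_norm.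
have D0 : 0 <= 1 + 2 * a + b * c by have := mulr_ge0 b0 c0; lra.
have -> : 4 * n%:R ^+ 3 * r * (1 + 2 * Psi / rho + (1 + L ^+ 2) / rho * s)
  = 4 * n%:R ^+ 3 * (r * (1 + 2 * (Psi / rho) + b * s)) by rewrite /b; ring.
have -> : 4 * n%:R ^+ 3 * (1 + 2 * `|Psi| / rho + (1 + L ^+ 2) / rho * c) * Mx
  = 4 * n%:R ^+ 3 * ((1 + 2 * a + b * c) * Mx) by rewrite /a /b; ring.
rewrite ler_wpM2l ?mulr_ge0 ?exprn_ge0 //.
(* T^(1 - gamma) >= 1 absorbs the terms that do not grow with T. *)
apply: (@le_trans _ _ (r * ((1 + 2 * a + b * c) * p))).
  rewrite ler_wpM2l // [leRHS]mulrDl; apply: lerD; last by rewrite -[leRHS]mulrA ler_wpM2l.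
  nra.
apply: (@le_trans _ _ ((1 + 2 * a + b * c) * ((1 + r) * p))); last by rewrite ler_wpM2l.
have : 0 <= (1 + 2 * a + b * c) * p by rewrite mulr_ge0 // (le_trans ler01).
have -> : (1 + 2 * a + b * c) * ((1 + r) * p) =
  (1 + 2 * a + b * c) * p + r * ((1 + 2 * a + b * c) * p) by ring.
lra.
Qed.

End Rates.

(** * From saddle points to regret *)

Section SumSaddleGap.
Context {R : realType} {n d m : nat}.
Variables (NX : 'cV[R]_d -> R) (NY : 'cV[R]_m -> R).
Variables (X : set 'cV[R]_d) (Y : set 'cV[R]_m).
Variables (F : nat -> 'I_n -> 'cV[R]_d -> 'cV[R]_m -> R) (LX LY : R) (T : nat).
Variable DF : nat -> 'I_n -> 'cV[R]_d -> 'cV[R]_m -> 'cV[R]_d.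
Hypotheses (LX0 : 0 <= LX) (LY0 : 0 <= LY).
Hypothesis Fgrad : forall t i a b y, (1 <= t <= T)%N -> X a -> X b -> Y y ->
  F t i a y - F t i b y <= inner (DF t i a y) (a - b).
Hypothesis FlipX : forall t i a b y, (1 <= t <= T)%N -> X a -> X b -> Y y ->
  F t i a y - F t i b y <= LX * NX (a - b).
Hypothesis FlipY : forall t i a y y', (1 <= t <= T)%N -> X a -> Y y -> Y y' ->
  F t i a y - F t i a y' <= LY * NY (y - y').

Lemma sum_saddle_gap xs ys (x : nat -> 'I_n -> 'cV[R]_d) (y : nat -> 'I_n -> 'cV[R]_m) j ux uy :
  (forall t, (1 <= t <= T)%N -> saddle_point X Y (fun a b => \sum_i F t i a b) (xs t) (ys t)) ->
  (forall t i, (1 <= t <= T)%N -> X (x t i)) -> (forall t i, (1 <= t <= T)%N -> Y (y t i)) ->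
  (forall i i', \sum_(1 <= t < T.+1) NX (x t i - x t i') <= ux) ->
  (forall i i', \sum_(1 <= t < T.+1) NY (y t i - y t i') <= uy) ->
  \sum_(1 <= t < T.+1) \sum_i F t i (x t j) (y t j)
    - \sum_(1 <= t < T.+1) \sum_i F t i (xs t) (ys t)
  <= \sum_(1 <= t < T.+1) \sum_i inner (DF t i (x t i) (y t i)) (x t i - xs t)
     + n%:R * (LX * ux + 2 * LY * uy).
Proof.
move=> sp Xx Yy hx hy; rewrite -sumrB.
apply: (@le_trans _ _ (\sum_(1 <= t < T.+1)
  (\sum_i inner (DF t i (x t i) (y t i)) (x t i - xs t)
   + \sum_i (LX * NX (x t j - x t i)
       + (LY * NY (y t j - y t i) + LY * NY (y t i - y t j)))))).
  apply: ler_sum_nat => t tT.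
  apply: (@saddle_gap _ _ _ _ NX NY X Y (F t) LX LY (DF t) _ _ _ (xs t) (ys t) (x t) (y t) j (sp t tT)).
  - by move=> *; apply: Fgrad.
  - by move=> *; apply: FlipX.
  - by move=> *; apply: FlipY.
  - by move=> i; apply: Xx.
  - by move=> i; apply: Yy.
rewrite big_split lerD2l exchange_big /= mulr_natl -[n in _ *+ n]card_ord -sumr_const.
apply: ler_sum => i _; rewrite !big_split /= -!mulr_sumr.
have := ler_wpM2l LX0 (hx j i); have := ler_wpM2l LY0 (hy j i).
have := ler_wpM2l LY0 (hy i j); lra.
Qed.

End SumSaddleGap.

(** * The history sigma-fields *)

Section History.
Context {R : realType} {disp : measure_display} {Omega : measurableType disp}.
Variables (n d m : nat) (gx : oracle R Omega n d m d) (gy : oracle R Omega n d m m).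
Variable r : run R Omega n d m.

Lemma history_setT t : history gx gy r t setT.
Proof.
exact: (@measurableT _ (g_sigma_algebraType
  (\bigcup_(s in [set s | (1 <= s <= t)%N]) \bigcup_(i in [set: 'I_n]) round_events gx gy r i s))).
Qed.

Lemma history_measurable t :
  (forall s i, (1 <= s <= t)%N -> round_events gx gy r i s `<=` measurable) ->
  history gx gy r t `<=` measurable.
Proof.
move=> rm; apply: smallest_sub; first exact: sigma_algebra_measurable.
by move=> C [s st [i _]]; apply: rm.
Qed.

Lemma measurable_xtilde t i : (1 <= t)%N -> measurable_vec (history gx gy r t) (run_xtilde r i t).
Proof.
move=> t1 C hC; apply: sub_gen_smallest; exists t; first by rewrite /= t1 leqnn.
by exists i => //; left; right.
Qed.

Lemma measurable_ytilde t i : (1 <= t)%N -> measurable_vec (history gx gy r t) (run_ytilde r i t).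
Proof.
move=> t1 C hC; apply: sub_gen_smallest; exists t; first by rewrite /= t1 leqnn.
by exists i => //; right.
Qed.

End History.

Lemma convex_function_gradient_le (R : realType) (d : nat) (g : 'cV[R]_d -> R^o) a b :
  convex_function setT g -> differentiable g a ->
  g a - g b <= inner (gradient g a) (a - b).
Proof.
move=> cg dg; have := convex_function_gradient b cg dg.
by rewrite -[b - a]opprB innerNr; lra.
Qed.

(** The order of quantifiers renders the O convention: the constant sees only what stands before
    [exists2]. [PsiX] and [PsiY] are plain reals there and are identified with the Bregman maxima
    later. *)
Theorem corollary1 (R : realType) (n d m : nat)
    (LX LY rhox rhoy KX KY eps1 eps2 gamma1 gamma2 PsiX PsiY : R)
    (x1 : 'I_n -> 'cV[R]_d) (y1 : 'I_n -> 'cV[R]_m) :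
  0 < rhox -> 0 < rhoy -> 0 < eps1 -> 0 < eps2 ->
  0 < gamma1 < 1 -> 0 < gamma2 < 1 ->
  (* the constant hidden in the O *)
  exists2 K : R, 0 < K &
  forall
    (* norms, decision sets, distance generating functions *)
    (nX : 'cV[R]_d -> R) (nY : 'cV[R]_m -> R)
    (X : set 'cV[R]_d) (Y : set 'cV[R]_m) (MX MY : R)
    (Rx : 'cV[R]_d -> R) (Ry : 'cV[R]_m -> R)
    (* payoffs, saddle points, prediction matrices *)
    (f : 'I_n -> nat -> 'cV[R]_d -> 'cV[R]_m -> R)
    (xs : nat -> 'cV[R]_d) (ys : nat -> 'cV[R]_m)
    (B : nat -> 'M[R]_d) (C : nat -> 'M[R]_m)
    (* network *)
    (zeta : R) (Q : nat) (E : nat -> rel 'I_n) (A : nat -> 'M[R]_n),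
  is_norm nX -> is_norm nY ->
  convex_set X -> convex_set Y -> compact X -> compact Y ->
  0 < MX -> 0 < MY ->
  (forall a b, X a -> X b -> nX (a - b) <= MX) ->
  (forall a b, Y a -> Y b -> nY (a - b) <= MY) ->
  (forall x, differentiable (Rx : 'cV[R]_d -> R^o) x) ->
  (forall y, differentiable (Ry : 'cV[R]_m -> R^o) y) ->
  strongly_convex_on nX X rhox Rx -> strongly_convex_on nY Y rhoy Ry ->
  PsiX = bregman_max Rx X -> PsiY = bregman_max Ry Y ->
  (forall i, X (x1 i)) -> (forall i, Y (y1 i)) ->
  (forall i t, (1 <= t)%N ->
    [/\ forall y, convex_function setT (fun x => f i t x y),
        forall x, convex_function setT (fun y => - f i t x y),
        forall x y, X x -> Y y ->
          differentiable ((fun x' => f i t x' y) : 'cV[R]_d -> R^o) x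
      & forall x y, X x -> Y y ->
          differentiable ((fun y' => f i t x y') : 'cV[R]_m -> R^o) y]) ->
  (forall t, (1 <= t)%N ->
    saddle_point X Y (total_payoff f t) (xs t) (ys t)) ->
  0 < zeta < 1 ->
  (forall t, (1 <= t)%N -> weight_matrix zeta E t (A t)) ->
  (* Assumption 1 *)
  (0 < Q)%N -> jointly_strongly_connected Q E ->
  (* Assumption 3 *)
  bregman_lipschitz nX X Rx KX -> bregman_lipschitz nY Y Ry KY ->
  bregman_separately_convex n Rx -> bregman_separately_convex n Ry ->
  (* V_T = o(T) *)
  (path_variation nX nY B C xs ys : nat -> R^o)
    =o_\oo ((fun T : nat => T%:R) : nat -> R^o) ->
  forall (T : nat), (2 <= T)%N ->
  (* Assumption 4 *)
  (forall t, (1 <= t <= T)%N ->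
    admissible_prediction nX X Rx (B t) /\
    admissible_prediction nY Y Ry (C t)) ->
  forall (disp : measure_display) (Omega : measurableType disp)
    (P : probability Omega R)
    (gx : oracle R Omega n d m d) (gy : oracle R Omega n d m m)
    (r : run R Omega n d m),
  (* Algorithm DOSMD-CCO and Assumption 2 *)
  independent_oracles P X Y gx gy T ->
  dosmd_cco_run X Y Rx Ry E A B C
    (step_size eps1 gamma1) (step_size eps2 gamma2) x1 y1 gx gy r T ->
  unbiased_bounded_oracles P nX nY X Y f LX LY gx gy r T ->
  forall j : 'I_n,
  (esp_regret P f xs ys r j T
   <= (K * Num.max
            ((1 + net_Gamma n Q zeta / (1 - net_sigma n Q zeta))
               * T%:R `^ Num.max (1 - gamma1) (1 - gamma2))
            (T%:R `^ Num.max gamma1 gamma2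
               * (1 + path_variation nX nY B C xs ys T)))%:E)%E.
Proof.
move=> rhox0 rhoy0 eps10 eps20 g1 g2.
pose sX := regret_constant n PsiX KX LX rhox eps1 gamma1.
pose sY := regret_constant n PsiY KY LY rhoy eps2 gamma2.
pose dX := disagreement_constant n PsiX LX rhox eps1 gamma1.
pose dY := disagreement_constant n PsiY LY rhoy eps2 gamma2.
have sX0 : 0 <= sX by exact: regret_constant_ge0.
have sY0 : 0 <= sY by exact: regret_constant_ge0.
have dX0 : 0 <= dX by exact: disagreement_constant_ge0.
have dY0 : 0 <= dY by exact: disagreement_constant_ge0.
(* Lipschitz constants of the payoffs, from [gradient_dual_bound]. *)
pose gX := 1 + LX ^+ 2; pose gY := 1 + LY ^+ 2.
have gX0 : 0 <= gX by rewrite addr_ge0 // sqr_ge0.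
have gY0 : 0 <= gY by rewrite addr_ge0 // sqr_ge0.
(* Constants for the upper and the lower bound on the expected gap. The doubled terms belong to the
   opponent, whose point moves twice in [saddle_gap]. *)
pose KX' := sX + n%:R * (gX * dX + 2 * gY * dY).
pose KY' := sY + n%:R * (gY * dY + 2 * gX * dX).
have KX'0 : 0 <= KX'.
  apply: addr_ge0 => //; apply: mulr_ge0 => //.
  by apply: addr_ge0; [exact: mulr_ge0 | apply: mulr_ge0 => //; exact: mulr_ge0].
have KY'0 : 0 <= KY'.
  apply: addr_ge0 => //; apply: mulr_ge0 => //.
  by apply: addr_ge0; [exact: mulr_ge0 | apply: mulr_ge0 => //; exact: mulr_ge0].
exists (1 + (KX' + KY')); first by rewrite ltr_pwDl // addr_ge0.
move=> nX nY X Y MX MY Rx Ry f xs ys B C zeta Q E A nnX nnY cvX cvY _ _ _ _ XM YM.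
move=> dRx dRy scX scY PX PY x1X y1Y fh sp z01 AE Q0 jsc lipX lipY cxX cxY _.
move=> T T2 adm disp Omega P gx gy r _ [r1 rT] ub j.
have T1 : (1 <= T)%N := ltnW T2.
have n0 : (0 < n)%N by apply: leq_trans (ltn_ord j).
pose past t := history gx gy r t.-1.
have BX t : (1 <= t <= T)%N -> admissible_prediction nX X Rx (B t).
  by move=> /adm[].
have CY t : (1 <= t <= T)%N -> admissible_prediction nY Y Ry (C t).
  by move=> /adm[].
have xsX t : (1 <= t)%N -> X (xs t) by move=> /sp[].
have ysY t : (1 <= t)%N -> Y (ys t) by move=> /sp[].
have xtP t i w : (1 <= t <= T)%N ->
    is_argmin_on X (fun x => bregman Rx x (run_z r i t w)) (run_xtilde r i t w).
  by move=> tT; have [_ /(_ w)[]] := rT t tT i.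
have ytP t i w : (1 <= t <= T)%N ->
    is_argmin_on Y (fun y => bregman Ry y (run_v r i t w)) (run_ytilde r i t w).
  by move=> tT; have [_ /(_ w)[]] := rT t tT i.
have xS t i w : (1 <= t <= T)%N -> run_x r i t.+1 w =
    \sum_(k | in_neighbour E t i k) A t i k *: (B t *m run_xtilde r k t w).
  by move=> tT; have [_ /(_ w)[]] := rT t tT i.
have yS t i w : (1 <= t <= T)%N -> run_y r i t.+1 w =
    \sum_(k | in_neighbour E t i k) A t i k *: (C t *m run_ytilde r k t w).
  by move=> tT; have [_ /(_ w)[]] := rT t tT i.
have x1X' i w : X (run_x r i 1 w) by rewrite (r1 i w).1.
have y1Y' i w : Y (run_y r i 1 w) by rewrite (r1 i w).2.
have xX t i w : (1 <= t <= T)%N -> X (run_x r i t w).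
  move=> tT; apply: (decision_in AE cvX BX (x := fun t i => run_x r i t w)
    (xt := fun t i => run_xtilde r i t w)) => //; last by case/andP: tT => -> /leqW.
  - by move=> s k sT; case: (xtP s k w sT).
  - by move=> s k sT; exact: xS.
have yY t i w : (1 <= t <= T)%N -> Y (run_y r i t w).
  move=> tT; apply: (decision_in AE cvY CY (x := fun t i => run_y r i t w)
    (xt := fun t i => run_ytilde r i t w)) => //; last by case/andP: tT => -> /leqW.
  - by move=> s k sT; case: (ytP s k w sT).
  - by move=> s k sT; exact: yS.
have pastT t : past t setT by exact: history_setT.
have pastm t : (1 <= t <= T)%N -> past t `<=` measurable.
  move=> tT; apply: history_measurable => s i sT.
  have sT' : (1 <= s <= T)%N.
    case/andP: sT tT => -> st /andP[_ tT] /=.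
    exact: leq_trans st (leq_trans (leq_pred t) tT).
  by have [] := rT s sT' i.
(* The first decisions are constants, measurable for any field; later ones mix the [run_xtilde] of
   the round before, which is why [past] stops at t - 1. *)
have xm t i : (1 <= t <= T)%N -> measurable_vec (past t) (run_x r i t).
  case: t => // -[|t] tT.
    have -> : run_x r i 1 = cst (x1 i) by apply/funext => w; rewrite (r1 i w).1.
    exact: measurable_vec_cst.
  have -> : run_x r i t.+2 = fun w => \sum_(k | in_neighbour E t.+1 i k)
      A t.+1 i k *: (B t.+1 *m run_xtilde r k t.+1 w).
    by apply/funext => w; rewrite xS //= ltnW.
  by apply: measurable_vec_mix => k; exact: measurable_xtilde.
have ym t i : (1 <= t <= T)%N -> measurable_vec (past t) (run_y r i t).
  case: t => // -[|t] tT.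
    have -> : run_y r i 1 = cst (y1 i) by apply/funext => w; rewrite (r1 i w).2.
    exact: measurable_vec_cst.
  have -> : run_y r i t.+2 = fun w => \sum_(k | in_neighbour E t.+1 i k)
      A t.+1 i k *: (C t.+1 *m run_ytilde r k t.+1 w).
    by apply/funext => w; rewrite yS //= ltnW.
  by apply: measurable_vec_mix => k; exact: measurable_ytilde.
(* The oracle assumption is used at the random decisions for the regret ([ubr]) and at constant
   points for the Lipschitz constants ([ubc]). *)
have ubr t i : (1 <= t <= T)%N -> _ := fun tT => ub i t tT (run_x r i t) (run_y r i t)
  (fun w => xX t i w tT) (fun w => yY t i w tT) (xm t i tT) (ym t i tT).
have ubc t i a b : (1 <= t <= T)%N -> X a -> Y b -> _ := fun tT Xa Yb => ub i t tT
  (cst a) (cst b) (fun=> Xa) (fun=> Yb) (@measurable_vec_cst _ _ _ _ _ a) (@measurable_vec_cst _ _ _ _ _ b).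
pose DX i t x y := gradient (fun x' => f i t x' y) x.
pose DY i t x y := gradient (fun y' => f i t x y') y.
have DXb t i a b v : (1 <= t <= T)%N -> X a -> Y b -> inner (DX i t a b) v <= gX * nX v.
  move=> tT Xa Yb; have [ubG _ ubS _] := ubc t i a b tT Xa Yb.
  exact: (@gradient_dual_bound R d disp Omega P nX nnX (past t)
    (fun w => gx i t a b w) (DX i t a b) v LX (pastT t) ubG ubS).
have DYb t i a b v : (1 <= t <= T)%N -> X a -> Y b -> inner (DY i t a b) v <= gY * nY v.
  move=> tT Xa Yb; have [_ ubG _ ubS] := ubc t i a b tT Xa Yb.
  exact: (@gradient_dual_bound R m disp Omega P nY nnY (past t)
    (fun w => gy i t a b w) (DY i t a b) v LY (pastT t) ubG ubS).
have t1T t : (1 <= t <= T)%N -> (1 <= t)%N by case/andP.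
have fx t i a b y : (1 <= t <= T)%N -> X a -> X b -> Y y ->
    f i t a y - f i t b y <= inner (DX i t a y) (a - b).
  move=> /t1T t1 Xa Xb Yy; have [cx _ dx _] := fh i t t1.
  exact: convex_function_gradient_le (cx y) (dx a y Xa Yy).
have fy t i x a b : (1 <= t <= T)%N -> X x -> Y a -> Y b ->
    f i t x b - f i t x a <= inner (- DY i t x a) (a - b).
  move=> /t1T t1 Xx Ya Yb; have [_ cy _ dy] := fh i t t1.
  have dya := dy x a Xx Ya.
  have := convex_function_gradient_le b (cy x) (differentiableN dya).
  by rewrite (gradientN dya) opprK addrC.
have fLX t i a b y : (1 <= t <= T)%N -> X a -> X b -> Y y ->
    f i t a y - f i t b y <= gX * nX (a - b).
  by move=> tT Xa Xb Yy; rewrite (le_trans (fx _ _ _ _ _ tT Xa Xb Yy)) // DXb.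
have fLY t i x a b : (1 <= t <= T)%N -> X x -> Y a -> Y b ->
    f i t x a - f i t x b <= gY * nY (a - b).
  move=> tT Xx Ya Yb; rewrite (le_trans (fy _ _ _ _ _ tT Xx Yb Ya)) //.
  by rewrite innerNl -innerNr opprB DYb.
have [UX [ISX ESX IUX hUX EUX]] := one_side_bounds (P := P) (L := LX) Q0 z01 jsc AE nnX cvX T1 BX
  rhox0 XM dRx scX lipX cxX (@step_size_gt0 R eps1 gamma1 eps10)
  (step_size_noninc eps10 g1) xsX (x := fun t i => run_x r i t)
  (xt := fun t i => run_xtilde r i t) (z := fun t i => run_z r i t)
  (G := fun t i => query gx r i t)
  (H := fun t i w => DX i t (run_x r i t w) (run_y r i t w))
  x1X' xtP xS
  (fun t i w tT => let: conj _ h := rT t tT i in let: And5 h' _ _ _ _ := h w in h'.1)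
  pastT pastm xm
  (fun t i k tT => let: And4 h _ _ _ := ubr t i tT in h k)
  (fun t i tT => let: And4 _ _ h _ := ubr t i tT in h).
(* The ascent step in y is a descent step for the negated answers, so the one-player bounds apply
   with [- DY] as conditional mean. *)
have [UY [ISY ESY IUY hUY EUY]] : exists U : Omega -> R,
  let S w := \sum_(1 <= t < T.+1) \sum_i inner (- DY i t (run_x r i t w) (run_y r i t w))
       (run_y r i t w - ys t) in
  [/\ integ P S,
      Rintegral P setT S <= n%:R * (bregman_max Ry Y + `|KY| * path_length nY C ys T)
               / step_size eps2 gamma2 T
               + n%:R * LY ^+ 2 / (2 * rhoy) * \sum_(1 <= t < T.+1) step_size eps2 gamma2 t,
      integ P U,
      forall w i k, \sum_(1 <= t < T.+1) nY (run_y r i t w - run_y r k t w) <= U w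
    & Rintegral P setT U <= 4 * n%:R ^+ 3 * (net_Gamma n Q zeta / (1 - net_sigma n Q zeta))
       * (1 + 2 * bregman_max Ry Y / rhoy
          + (1 + LY ^+ 2) / rhoy * \sum_(1 <= s < T.+1) step_size eps2 gamma2 s)].
  apply: (one_side_bounds (P := P) (L := LY) Q0 z01 jsc AE nnY cvY T1 CY
    rhoy0 YM dRy scY lipY cxY (@step_size_gt0 R eps2 gamma2 eps20)
    (step_size_noninc eps20 g2) ysY (x := fun t i => run_y r i t)
    (xt := fun t i => run_ytilde r i t) (z := fun t i => run_v r i t)
    (G := fun t i w => - query gy r i t w)
    (H := fun t i w => - DY i t (run_x r i t w) (run_y r i t w))
    y1Y' ytP yS _ pastT pastm ym).
  - move=> t i w tT; have [_ /(_ w)[[_ ->] _ _ _ _]] := rT t tT i.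
    by rewrite scalerN opprK.
  - move=> t i k tT; have [_ ubG _ _] := ubr t i tT.
    have := is_condexpN (pastm t tT) (ubG k).
    by congr is_condexp; apply/funext => w; rewrite !mxE.
  - move=> t i tT; have [_ _ _ [S SG SL]] := ubr t i tT; exists S => //.
    by move: SG; congr is_condexp; apply/funext => w; rewrite (dual_normN nnY).
pose V := path_variation nX nY B C xs ys T.
pose rr := net_Gamma n Q zeta / (1 - net_sigma n Q zeta).
set Mx := Num.max _ _.
have VX : 0 <= path_length nX B xs T <= V.
  rewrite le_max lexx andbT; apply: sumr_ge0 => t _; exact: is_norm_ge0.
have VY : 0 <= path_length nY C ys T <= V.
  rewrite le_max lexx orbT andbT; apply: sumr_ge0 => t _; exact: is_norm_ge0.
have rr0 : 0 <= rr.
  by rewrite divr_ge0 ?powR_ge0 // subr_ge0 ltW // net_sigma_lt1.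
have T1R : 1 <= T%:R :> R by rewrite ler1n.
have V1 : 0 <= 1 + V by have /andP[p0 pV] := VX; rewrite addr_ge0 // (le_trans p0).
have rM g : g <= Num.max (1 - gamma1) (1 - gamma2) -> (1 + rr) * T%:R `^ g <= Mx.
  move=> gm; rewrite /Mx le_max; apply/orP; left.
  by rewrite ler_wpM2l ?addr_ge0 // ler_powR.
have rM' g : g <= Num.max (1 - gamma1) (1 - gamma2) -> T%:R `^ g <= Mx.
  move=> /rM; apply: le_trans; by rewrite ler_peMl ?powR_ge0 // lerDl.
have VM g : g <= Num.max gamma1 gamma2 -> T%:R `^ g * (1 + V) <= Mx.
  move=> gm; rewrite /Mx le_max; apply/orP; right.
  by rewrite ler_wpM2r // ler_powR.
have gl1 : 1 - gamma1 <= Num.max (1 - gamma1) (1 - gamma2) by rewrite le_max lexx.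
have gl2 : 1 - gamma2 <= Num.max (1 - gamma1) (1 - gamma2) by rewrite le_max lexx orbT.
have gm1 : gamma1 <= Num.max gamma1 gamma2 by rewrite le_max lexx.
have gm2 : gamma2 <= Num.max gamma1 gamma2 by rewrite le_max lexx orbT.
rewrite -PX in ESX EUX; rewrite -PY in ESY EUY.
have {}ESX := le_trans ESX (regret_rate n PsiX KX LX rhox0 eps10 g1 VX (rM' _ gl1) (VM _ gm1)).
have {}ESY := le_trans ESY (regret_rate n PsiY KY LY rhoy0 eps20 g2 VY (rM' _ gl2) (VM _ gm2)).
have {}EUX := le_trans EUX (disagreement_rate n PsiX LX rhox0 eps10 g1 T1 rr0 (rM _ gl1)).
have {}EUY := le_trans EUY (disagreement_rate n PsiY LY rhoy0 eps20 g2 T1 rr0 (rM _ gl2)).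
have Mx0 : 0 <= Mx by apply: le_trans (rM _ gl1); rewrite mulr_ge0 ?powR_ge0 ?addr_ge0.
pose gap w := \sum_(1 <= t < T.+1) total_payoff f t (run_x r j t w) (run_y r j t w)
  - \sum_(1 <= t < T.+1) total_payoff f t (xs t) (ys t).
have Ebound (S U1 U2 : Omega -> R) s c1 c2 d1 d2 : integ P S -> integ P U1 -> integ P U2 ->
    0 <= c1 -> 0 <= c2 ->
    Rintegral P setT S <= s * Mx -> Rintegral P setT U1 <= d1 * Mx ->
    Rintegral P setT U2 <= d2 * Mx ->
    integ P (fun w => S w + n%:R * (c1 * U1 w + c2 * U2 w)) /\
    Rintegral P setT (fun w => S w + n%:R * (c1 * U1 w + c2 * U2 w))
      <= (s + n%:R * (c1 * d1 + c2 * d2)) * Mx.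
  move=> IS I1 I2 c10 c20 ES E1 E2.
  have I12 : integ P (fun w => c1 * U1 w + c2 * U2 w) by apply: integD; exact: integZ.
  split; first by apply: integD => //; exact: integZ.
  rewrite ExD //; last exact: integZ.
  rewrite ExZ // ExD; [|exact: integZ|exact: integZ].
  rewrite !ExZ // mulrDl; apply: lerD => //.
  rewrite -mulrA ler_wpM2l // mulrDl -!mulrA.
  by apply: lerD; rewrite ler_wpM2l.
have [IhX EhX] := Ebound _ _ _ _ _ _ _ _ ISX IUX IUY gX0 (mulr_ge0 (ler0n _ 2) gY0) ESX EUX EUY.
have [IhY EhY] := Ebound _ _ _ _ _ _ _ _ ISY IUY IUX gY0 (mulr_ge0 (ler0n _ 2) gX0) ESY EUY EUX.
have gap_le w := @sum_saddle_gap R n d m nX nY X Y (fun t i => f i t) gX gY T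
  (fun t i => DX i t) gX0 gY0 (fun t i a b y => @fx t i a b y)
  (fun t i a b y => @fLX t i a b y) (fun t i x a b => @fLY t i x a b) xs ys
  (fun t i => run_x r i t w) (fun t i => run_y r i t w) j _ _
  (fun t tT => sp t (t1T t tT)) (fun t i => xX t i w) (fun t i => yY t i w) (hUX w) (hUY w).
have gap_ge w : - gap w <= \sum_(1 <= t < T.+1)
    \sum_i inner (- DY i t (run_x r i t w) (run_y r i t w)) (run_y r i t w - ys t)
    + n%:R * (gY * UY w + 2 * gX * UX w).
  have -> : - gap w = \sum_(1 <= t < T.+1) \sum_i - f i t (run_x r j t w) (run_y r j t w)
      - \sum_(1 <= t < T.+1) \sum_i - f i t (xs t) (ys t).
    have sumN (F : nat -> 'I_n -> R) : \sum_(1 <= t < T.+1) \sum_i - F t i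
        = - \sum_(1 <= t < T.+1) \sum_i F t i.
      by rewrite -sumrN; apply: eq_bigr => t _; rewrite sumrN.
    by rewrite !sumN /gap /total_payoff opprB opprK addrC.
  apply: (@sum_saddle_gap R n m d nY nX Y X (fun t i y x => - f i t x y) gY gX T
    (fun t i y x => - DY i t x y) gY0 gX0 _ _ _ ys xs
    (fun t i => run_y r i t w) (fun t i => run_x r i t w) j (UY w) (UX w)).
  - by move=> t i a b x tT Ya Yb Xx; rewrite opprK addrC; exact: fy.
  - move=> t i a b x tT Ya Yb Xx.
    by rewrite opprK addrC (is_norm_sub nnY); exact: fLY.
  - move=> t i y a b tT Yy Xa Xb.
    by rewrite opprK addrC (is_norm_sub nnX); exact: fLX.
  - move=> t /t1T t1; have [Xs Ys sy sx] := sp t t1; split => //.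
    + by move=> a Xa; rewrite !sumrN lerN2; exact: sx.
    + by move=> b Yb; rewrite !sumrN lerN2; exact: sy.
  - by move=> t i tT; exact: yY.
  - by move=> t i tT; exact: xX.
  - exact: hUY.
  - exact: hUX.
have up : ('E_P[gap] <= _)%E := expectation_le_integ IhX gap_le.
have lo := expectation_ge_integ IhY (fun w => etrans (lerNl _ _) (gap_ge w)).
rewrite /esp_regret -/gap.
(* Real bounds on both sides make the extended expectation finite, so its absolute value can be
   treated as a real number. *)
have fin : ('E_P[gap])%E \is a fin_num.
  by rewrite fin_numE; apply/andP; split; apply/eqP => eg; move: up lo; rewrite eg.
move: up lo; rewrite -(fineK fin) abse_EFin !lee_fin => up lo.
rewrite ler_norml; apply/andP.
have hX : 0 <= KX' * Mx by rewrite mulr_ge0.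
have hY : 0 <= KY' * Mx by rewrite mulr_ge0.
have -> : (1 + (KX' + KY')) * Mx = Mx + KX' * Mx + KY' * Mx by ring.
rewrite -/KX' in EhX; rewrite -/KY' in EhY.
clear - up lo EhX EhY hX hY Mx0; split; lra.
Qed.
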